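(* For any $r\in(0,1)$, let $$v_m=\max\Big\{\Big\lfloor\frac m2+\frac{\sqrt m}{2}Q^{-1}(1-r)\Big\rfloor,0\Big\}.$$ Then the rate $r_m$ of $\mathrm{RM}(v_m,m)$ satisfies $r_m\to r$ as $m\to\infty$, and the sequence $\{\mathrm{RM}(v_m,m)\}_m$ is capacity achieving on the BEC under bit-MAP decoding.
   Context: $Q(t)=\frac1{\sqrt{2\pi}}\int_t^\infty e^{-\tau^2/2}d\tau$. $\mathrm{RM}(v,m)$ is the binary code of length $N=2^m$ consisting of the evaluation vectors $(f(\underline{x}))_{\underline{x}\in\{0,1\}^m}$ of all polynomials $f$ over $\mathbb{F}_2$ in the span of multilinear monomials in $x_1,\dots,x_m$ of degree at most $v$; its rate is $2^{-m}\sum_{k=0}^v\binom mk$. A uniform codeword $\underline{X}$ is sent over $\mathrm{BEC}(p)$ (each bit erased independently with probability $p$), giving $\underline{Y}$; $P_b(p)=\frac1N\sum_i\Pr(X_i\text{ not uniquely determined by }\underline{Y})$. A code sequence with rates $r_n\to r\in(0,1)$ is capacity achieving under bit-MAP decoding if $P_b^{(n)}(p)\to0$ for every $p\in[0,1-r)$. *)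

(* Defs.v *)
From Stdlib Require Import Reals ZArith.
From mathcomp Require Import all_boot.

Unset Printing Implicit Defensive.

Local Open Scope R_scope.

Definition gauss (tau : R) : R := / sqrt (2 * PI) * exp (- tau ^ 2 / 2).

(* Qval t q  :<->  Q(t) = q, where Q(t) = 1/sqrt(2 pi) * int_t^oo e^{-tau^2/2} dtau,
   the improper Riemann integral being the limit b -> +oo of int_t^b. *)
Definition Qval (t q : R) : Prop :=
  forall eps, 0 < eps -> exists B, forall b, B <= b -> t <= b ->
    exists pr : Riemann_integrable gauss t b, Rabs (RiemannInt pr - q) < eps.

(* Points of F_2^m and binary words of length N = 2^m indexed by them. *)
Definition point (m : nat) := {ffun 'I_m -> bool}.
Definition word (m : nat) := {ffun point m -> bool}.

(* Evaluation of the multilinear monomial prod_{i in S} x_i at x. *)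
Definition monom (m : nat) (S : {set 'I_m}) (x : point m) : bool :=
  [forall i in S, x i].

(* w is in RM(v,m): w is the evaluation vector of an F_2-linear combination
   (coefficients a) of multilinear monomials of degree at most v. *)
Definition inRM (v m : nat) (w : word m) : bool :=
  [exists a : {ffun {set 'I_m} -> bool},
     [forall S : {set 'I_m}, (v < #|S|)%N ==> ~~ a S] &&
     [forall x : point m,
        w x == \big[addb/false]_(S : {set 'I_m}) (a S && monom m S x)]].

Definition RM_rate (v m : nat) : R :=
  INR (\sum_(0 <= k < v.+1) 'C(m, k))%N / 2 ^ m.

Definition RM_card (v m : nat) : R := INR #|[pred w : word m | inRM v m w]|.

(* Given sent codeword X and erased set E of positions (Y reveals X_j for
   j not in E), X_i is not uniquely determined by Y iff some codeword
   agreeing with X outside E differs from X at i. *)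
Definition ambiguous (v m : nat) (X : word m) (E : {set point m}) (i : point m)
  : bool :=
  [exists X' : word m, [&& inRM v m X', X' i != X i &
      [forall j : point m, (j \notin E) ==> (X' j == X j)]]].

Definition erasure_prob (m : nat) (p : R) (E : {set point m}) : R :=
  p ^ #|E| * (1 - p) ^ (#|[set: point m]| - #|E|)%N.

(* P_b(p) for RM(v,m) under bit-MAP decoding, uniform codeword on BEC(p). *)
Definition RM_Pb (v m : nat) (p : R) : R :=
  / 2 ^ m *
  \big[Rplus/0]_(i : point m)
    \big[Rplus/0]_(X : word m | inRM v m X)
      \big[Rplus/0]_(E : {set point m})
        (/ RM_card v m * erasure_prob m p E * (if ambiguous v m X E i then 1 else 0)).

(* v_m = max { floor(m/2 + sqrt(m)/2 * t), 0 }, with t = Q^{-1}(1-r). *)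
Definition v_seq (t : R) (m : nat) : nat :=
  Z.to_nat (Z.max (Int_part (INR m / 2 + sqrt (INR m) / 2 * t)) 0%Z).

(* Main.v *)
Require Import Defs.
From Stdlib Require Import Reals Lra.
From mathcomp Require Import all_boot all_order all_algebra polyrcf Rstruct zify.
From mathcomp Require ring lra.

(** Let [h_m] be the probability that bit [0] of RM(v,m) cannot be recovered from
    the other unerased bits, and [f] the corresponding event. Restricting the code
    to a linear hyperplane [A] of F_2^m gives RM(v,m-1), so the event [f_A] that [A]
    alone does not determine the bit contains [f], ignores the positions outside
    [A], and has probability [h_{m-1}]. A nonzero point lies outside more than half
    of the hyperplanes, hence so does every nontrivial Fourier character of the
    erasure pattern, and averaging Parseval's identity for [f - f_A] over [A] gives
    [h_m (1 - h_m) <= 2 (h_{m-1} - h_m)]. By the area theorem the right-hand side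
    integrates over [p] to [2 (R(v,m-1) - R(v,m)) = 'C(m-1,v) / 2^(m-1)], which
    tends to 0. As [h_m] is nondecreasing and integrates to the rate, it must vanish
    in the limit below [1 - r].

    The rate itself converges by the central limit theorem, proved by Lindeberg's
    replacement argument: the Gaussian distribution function solves the heat
    equation, so replacing one coin flip by a Gaussian step of the same variance
    costs a third-order error. *)

Set Implicit Arguments.
Unset Strict Implicit.
Unset Printing Implicit Defensive.

(** * The biased cube *)

Section BiasedCube.
Import Order.TTheory GRing.Theory Num.Theory.
Import mathcomp.algebra_tactics.ring mathcomp.algebra_tactics.lra.
Local Open Scope ring_scope.

(** The parameter ranges over any commutative ring so that [p] may be ['X]: the expectation is then
    a polynomial in the erasure probability, which can be differentiated and evaluated. *)
Definition mu (R : comNzRingType) (T : finType) (p : R) (E : {set T}) : R :=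
  \prod_j (if j \in E then p else 1 - p).

Definition expect (R : comNzRingType) (T : finType) (p : R) (f : {set T} -> R) : R :=
  \sum_(E : {set T}) mu p E * f E.

Definition mu_off (R : comNzRingType) (T : finType) (p : R) (j : T) (E : {set T}) : R :=
  \prod_(k | k != j) (if k \in E then p else 1 - p).

Lemma eq_expect (R : comNzRingType) (T : finType) (p : R) (f g : {set T} -> R) :
  f =1 g -> expect p f = expect p g.
Proof. by move=> fg; apply: eq_bigr => E _; rewrite fg. Qed.

Lemma prodrD_set (R : comNzRingType) (I : finType) (F G : I -> R) :
  \prod_i (F i + G i) = \sum_(J : {set I}) \prod_i (if i \in J then F i else G i).
Proof. exact: bigA_distr. Qed.

Lemma sum_mu (R : comNzRingType) (T : finType) (p : R) : \sum_(E : {set T}) mu p E = 1.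
Proof.
rewrite -(prodrD_set (fun=> p) (fun=> 1 - p)) big1 // => i _; exact: subrKC.
Qed.

Lemma expect_cst (R : comNzRingType) (T : finType) (p c : R) :
  expect p (fun _ : {set T} => c) = c.
Proof. by rewrite /expect -mulr_suml sum_mu mul1r. Qed.

Lemma expectB (R : comNzRingType) (T : finType) (p : R) (f g : {set T} -> R) :
  expect p (fun E => f E - g E) = expect p f - expect p g.
Proof.
by rewrite /expect -sumrB; apply: eq_bigr => E _; rewrite mulrBr.
Qed.

Lemma sum_set_split (R : comNzRingType) (T : finType) (j : T) (F : {set T} -> R) :
  \sum_(E : {set T}) F E = \sum_(E : {set T} | j \notin E) (F (j |: E) + F E).
Proof.
rewrite (bigID (fun E : {set T} => j \in E)) /= big_split /=; congr (_ + _).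
rewrite (reindex_onto (fun E => j |: E) (fun E => E :\ j)) /= => [|E jE]; last first.
  by rewrite setD1K.
apply: eq_bigl => E; rewrite setU11 /=; apply/eqP/idP => [<-|jE].
  by rewrite !inE eqxx.
by rewrite setU1K.
Qed.

Lemma mu_in (R : comNzRingType) (T : finType) (p : R) (j : T) (E : {set T}) :
  j \in E -> mu p E = p * mu_off p j E.
Proof. by move=> jE; rewrite /mu (bigD1 j) //= jE. Qed.

Lemma mu_notin (R : comNzRingType) (T : finType) (p : R) (j : T) (E : {set T}) :
  j \notin E -> mu p E = (1 - p) * mu_off p j E.
Proof. by move=> /negPf jE; rewrite /mu (bigD1 j) //= jE. Qed.

Lemma mu_offU (R : comNzRingType) (T : finType) (p : R) (j : T) (E : {set T}) :
  mu_off p j (j |: E) = mu_off p j E.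
Proof. by apply: eq_bigr => k /negPf kj; rewrite !inE kj. Qed.

Lemma expect_split (R : comNzRingType) (T : finType) (p : R) (j : T) (f : {set T} -> R) :
  expect p f =
  \sum_(E : {set T} | j \notin E) mu_off p j E * (p * f (j |: E) + (1 - p) * f E).
Proof.
rewrite /expect (sum_set_split j); apply: eq_bigr => E jE.
rewrite (mu_in p (setU11 j E)) (mu_notin p jE) mu_offU; ring.
Qed.

Lemma deriv_prod (R : comNzRingType) (I : finType) (P : pred I) (F : I -> {poly R}) :
  (\prod_(i | P i) F i)^`() = \sum_(i | P i) (F i)^`() * \prod_(k | P k && (k != i)) F k.
Proof.
have gen (s : seq I) : uniq s -> (\prod_(i <- s | P i) F i)^`() =
    \sum_(i <- s | P i) (F i)^`() * \prod_(k <- s | P k && (k != i)) F k.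
  elim: s => [|x s IH] /=; first by rewrite !big_nil derivC.
  case/andP=> xs us; rewrite !big_cons; case: ifP => Px; last first.
    by rewrite IH //; apply: eq_bigr => i _; rewrite big_cons Px.
  rewrite eqxx /= derivM IH //; congr (_ + _).
    congr (_ * _); rewrite big_seq_cond [RHS]big_seq_cond; apply: eq_bigl => i.
    case si: (i \in s) => //=; case: eqVneq => [ix|]; last by rewrite andbT.
    by rewrite -ix si in xs.
  rewrite big_distrr /= big_seq_cond [RHS]big_seq_cond; apply: eq_bigr => i /andP[si _].
  rewrite big_cons Px /=; case: eqVneq => [xi|_] /=; last by rewrite mulrCA.
  by rewrite xi si in xs.
exact: gen (index_enum_uniq I).
Qed.

(* Russo's formula. *)
Lemma deriv_expect (R : comNzRingType) (T : finType) (f : {set T} -> R) :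
  (expect 'X (fun E => (f E)%:P))^`() =
  \sum_j expect 'X (fun E => (f (j |: E) - f (E :\ j))%:P).
Proof.
rewrite /expect raddf_sum /=.
under eq_bigr => E _.
  rewrite derivM derivC mulr0 addr0 /mu deriv_prod mulr_suml.
  over.
rewrite exchange_big /=; apply: eq_bigr => j _.
rewrite (sum_set_split j) -[RHS]/(expect _ _) (expect_split _ j); apply: eq_bigr => E jE.
have -> : \prod_(k | k != j) (if k \in j |: E then 'X else 1 - 'X) = mu_off ('X : {poly R}) j E.
  exact: mu_offU.
rewrite setU11 (negPf jE) derivX derivB derivX derivC -/(mu_off _ _ _).
rewrite setUA setUid setU1K // (_ : E :\ j = E); last first.
  by apply/setDidPl; rewrite disjoint_sym disjoints1.
rewrite polyCB; ring.
Qed.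

Lemma horner_mu (R : comNzRingType) (T : finType) (p : R) (E : {set T}) :
  (mu 'X E).[p] = mu p E.
Proof.
by rewrite /mu horner_prod; apply: eq_bigr => j _; case: ifP; rewrite !hornerE.
Qed.

Lemma horner_expect (R : comNzRingType) (T : finType) (p : R) (f : {set T} -> R) :
  (expect 'X (fun E => (f E)%:P)).[p] = expect p f.
Proof.
by rewrite /expect horner_sum; apply: eq_bigr => E _; rewrite hornerM hornerC horner_mu.
Qed.

Lemma expect0 (R : comNzRingType) (T : finType) (f : {set T} -> R) :
  expect 0 f = f set0.
Proof.
rewrite /expect (bigD1 set0) //= big1 ?addr0 => [|E /set0Pn[j jE]].
  by rewrite /mu big1 ?mul1r // => j _; rewrite inE subr0.
by rewrite (mu_in _ jE) mul0r mul0r.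
Qed.

Lemma expect1 (R : comNzRingType) (T : finType) (f : {set T} -> R) :
  expect 1 f = f setT.
Proof.
rewrite /expect (bigD1 setT) //= big1 ?addr0 => [|E].
  by rewrite /mu big1 ?mul1r // => j _; rewrite inE.
rewrite eqEsubset subsetT /= => /subsetPn[j _ jE].
by rewrite (mu_notin _ jE) subrr mul0r mul0r.
Qed.

Lemma set_neq_ex (T : finType) (A B : {set T}) :
  A <> B -> exists j, (j \in A) != (j \in B).
Proof.
case: (pickP [pred j | (j \in A) != (j \in B)]) => [j jAB _|AB0]; first by exists j.
by case; apply/setP => j; apply/eqP; move: (AB0 j) => /= /negbFE.
Qed.

(** Distinct coordinates are independent: those in the image of [L] form a copy of the cube over
    [U], and the weights of all others sum to 1. It transports probabilities along translations and
    hyperplane embeddings. *)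
Lemma expect_preim (R : comNzRingType) (T U : finType) (L : U -> T) (p : R)
  (f : {set U} -> R) : injective L ->
  expect p (fun E : {set T} => f (L @^-1: E)) = expect p f.
Proof.
move=> injL; rewrite /expect (partition_big (fun E : {set T} => L @^-1: E) xpredT) //=.
apply: eq_bigr => D _.
under eq_bigr => E /eqP -> do [].
rewrite -mulr_suml; congr (_ * _).
(* The constraint [L @^-1: E = D] splits over coordinates: [A t] is the weight of [t \in E] and
   [B t] that of [t \notin E], each set to 0 where [D] forbids the choice. *)
pose A t := p *+ [forall u, (L u == t) ==> (u \in D)].
pose B t := (1 - p) *+ [forall u, (L u == t) ==> (u \notin D)].
rewrite big_mkcond /=.
transitivity (\prod_t (A t + B t)).
  rewrite prodrD_set; apply: eq_bigr => E _.
  case: eqP => [ED|nED].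
    apply: eq_bigr => t _; rewrite /A /B -ED; case: ifP => tE.
      rewrite (_ : [forall _, _]); first by [].
      by apply/forallP => u; apply/implyP => /eqP ut; rewrite inE ut.
    rewrite (_ : [forall _, _]); first by [].
    by apply/forallP => u; apply/implyP => /eqP ut; rewrite inE ut tE.
  have [u] := set_neq_ex nED; rewrite inE.
  rewrite (bigD1 (L u)) //= /A /B => H; apply/esym.
  case: ifP H => uE; case uD : (u \in D) => // _.
    rewrite (negPf (_ : ~~ [forall _, _])) ?mulr0n ?mul0r //.
    by apply/negP => /forallP/(_ u); rewrite eqxx uD.
  rewrite (negPf (_ : ~~ [forall _, _])) ?mulr0n ?mul0r //.
  by apply/negP => /forallP/(_ u); rewrite eqxx uD.
rewrite (bigID (fun t => t \in L @: [set: U])) /= [X in _ * X]big1 => [|t tL].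
  rewrite mulr1 big_imset /=; last by move=> x y _ _; apply: injL.
  rewrite /mu; apply: eq_big => [u|u _]; first by rewrite inE.
  have E1 : [forall u0, (L u0 == L u) ==> (u0 \in D)] = (u \in D).
    apply/forallP/idP => [/(_ u)|uD v]; first by rewrite eqxx.
    by apply/implyP => /eqP /injL ->.
  have E2 : [forall u0, (L u0 == L u) ==> (u0 \notin D)] = (u \notin D).
    apply/forallP/idP => [/(_ u)|uD v]; first by rewrite eqxx.
    by apply/implyP => /eqP /injL ->.
  by rewrite /A /B E1 E2; case: ifP => _; rewrite !(mulr1n, mulr0n, addr0, add0r).
have nL u : (L u == t) = false.
  by apply/negP => /eqP ut; move: tL; rewrite -ut imset_f ?inE.
have allT (Q : pred U) : [forall u, (L u == t) ==> Q u].
  by apply/forallP => u; rewrite nL.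
by rewrite /A /B (allT (mem D)) (allT (fun u => u \notin D)) subrKC.
Qed.

(** * Fourier analysis on the biased cube *)

Definition chi (R : comNzRingType) (T : finType) (p : R) (S E : {set T}) : R :=
  \prod_(j in S) ((j \in E)%:R - p).

Definition fourier (R : comNzRingType) (T : finType) (p : R) (f : {set T} -> R)
  (S : {set T}) : R := expect p (fun E => f E * chi p S E).

Definition indep_of (X : Type) (T : finType) (f : {set T} -> X) (j : T) :=
  forall E : {set T}, f (j |: E) = f (E :\ j).

Lemma indep_ofU (X : Type) (T : finType) (f : {set T} -> X) (j : T) (E : {set T}) :
  indep_of f j -> j \notin E -> f (j |: E) = f E.
Proof.
move=> /(_ E) -> jE; congr f; apply/setDidPl; by rewrite disjoint_sym disjoints1.
Qed.

(** The factor of [chi] at [j] has mean [p * (1 - p) + (1 - p) * (- p) = 0]. *)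
Lemma fourier_indep (R : comNzRingType) (T : finType) (p : R) (f : {set T} -> R)
  (S : {set T}) (j : T) : indep_of f j -> j \in S -> fourier p f S = 0.
Proof.
move=> fj jS; rewrite /fourier (expect_split _ j) big1 // => E jE.
rewrite (indep_ofU fj jE) /chi !(bigD1 j jS) /= setU11 (negPf jE).
set u := \prod_(_ | _) _; set w := \prod_(_ | _) _.
have -> : u = w.
  by apply: eq_bigr => k /andP[_ /negPf kj]; rewrite !inE kj.
rewrite [X in _ * X](_ : _ = 0) ?mulr0 //=; ring.
Qed.

Lemma fourier0 (R : comNzRingType) (T : finType) (p : R) (f : {set T} -> R) :
  fourier p f set0 = expect p f.
Proof. by apply: eq_expect => E; rewrite /chi big_set0 mulr1. Qed.

Lemma fourierB (R : comNzRingType) (T : finType) (p : R) (f g : {set T} -> R) (S : {set T}) :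
  fourier p (fun E => f E - g E) S = fourier p f S - fourier p g S.
Proof.
by rewrite /fourier -expectB; apply: eq_expect => E; rewrite mulrBl.
Qed.

(** The characters [chi] are left unnormalised to avoid square roots, hence the division by their
    variance. After expansion into a sum over pairs [E], [D], the sum over [S] factors over
    coordinates; a coordinate where [E] and [D] differ gives a factor 0, and the diagonal gives the
    inverse of [mu p E]. *)
Lemma parseval (F : fieldType) (T : finType) (p : F) (f : {set T} -> F) :
  p != 0 -> 1 - p != 0 ->
  expect p (fun E => f E ^+ 2) =
  \sum_S fourier p f S ^+ 2 / (p * (1 - p)) ^+ #|S|.
Proof.
move=> p0 q0; rewrite /fourier /expect.
transitivity (\sum_(S : {set T}) \sum_(E : {set T}) \sum_(D : {set T})
    (mu p E * f E) * (mu p D * f D) * \prod_(j in S)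
      (((j \in E)%:R - p) * ((j \in D)%:R - p) / (p * (1 - p)))); last first.
  apply: eq_bigr => S _; rewrite expr2 big_distrlr /= mulr_suml.
  apply: eq_bigr => E _; rewrite mulr_suml; apply: eq_bigr => D _.
  rewrite !big_split /= prodr_const exprVn /chi; ring.
rewrite exchange_big /=; apply: eq_bigr => E _.
rewrite exchange_big /= (bigD1 E) //= [X in _ + X]big1 => [|D DE].
  rewrite addr0 -mulr_sumr.
  have -> : \sum_(S : {set T}) \prod_(j in S)
      (((j \in E)%:R - p) * ((j \in E)%:R - p) / (p * (1 - p))) = (mu p E)^-1.
    under eq_bigr do rewrite big_mkcond /=.
    rewrite -prodrD_set /mu -prodfV; apply: eq_bigr => j _.
    by case: ifP => _ /=; field; rewrite p0 q0.
  have : mu p E != 0.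
    by apply/prodf_neq0 => j _; case: ifP.
  by move=> muE; field.
rewrite -mulr_sumr; under eq_bigr do rewrite big_mkcond /=.
rewrite -prodrD_set.
have [j Hj] := set_neq_ex (elimN eqP DE).
rewrite (bigD1 j) //=.
suff -> : ((j \in E)%:R - p) * ((j \in D)%:R - p) / (p * (1 - p)) + 1 = 0.
  by rewrite mul0r mulr0.
by case: (j \in E) Hj; case: (j \in D) => //= _; field; rewrite p0 q0.
Qed.

(* Each [f - g a] retains every Fourier coefficient of [f] on a set meeting the
   coordinates [g a] ignores, and every relevant coordinate is ignored by at least
   [k] of the [g a]. *)
Lemma variance_le (F : realFieldType) (T A : finType) (p : F) (f : {set T} -> F)
  (g : A -> {set T} -> F) (B : A -> {set T}) (k : nat) :
  0 < p -> p < 1 ->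
  (forall a j, j \in B a -> indep_of (g a) j) ->
  (forall j, indep_of f j \/ (k <= #|[set a | j \in B a]|)%N) ->
  k%:R * (expect p (fun E => f E ^+ 2) - expect p f ^+ 2) <=
  \sum_a expect p (fun E => (f E - g a E) ^+ 2).
Proof.
move=> p0 p1 gB fB.
have pn0 : p != 0 by rewrite gt_eqF.
have qn0 : 1 - p != 0 by rewrite gt_eqF // subr_gt0.
have w0 n : 0 <= ((p * (1 - p)) ^+ n)^-1 by rewrite invr_ge0 exprn_ge0 // mulr_ge0 ?subr_ge0 // ltW.
under [leRHS]eq_bigr do rewrite parseval //.
(* The empty set accounts exactly for the squared mean, which cancels on the left. *)
rewrite exchange_big /= parseval // (bigD1 set0) //= cards0 expr0 divr1 fourier0.
rewrite addrAC subrr add0r mulr_sumr [leRHS](bigD1 set0) //=.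
rewrite -[leLHS]add0r lerD //.
  by apply: sumr_ge0 => a _; rewrite mulr_ge0 ?sqr_ge0.
apply: ler_sum => S /set0Pn[j jS].
have [fj|kj] := fB j.
  rewrite (fourier_indep _ fj jS) expr0n mul0r mulr0.
  by apply: sumr_ge0 => a _; rewrite mulr_ge0 ?sqr_ge0.
have term_ge0 a : 0 <= fourier p (fun E => f E - g a E) S ^+ 2 / (p * (1 - p)) ^+ #|S|.
  by rewrite mulr_ge0 ?sqr_ge0.
apply: (@le_trans _ _ (\sum_(a in [set a | j \in B a])
   fourier p (fun E => f E - g a E) S ^+ 2 / (p * (1 - p)) ^+ #|S|)); last first.
  by rewrite [leRHS](bigID (mem [set a | j \in B a])) /= lerDl sumr_ge0.
under eq_bigr => a /[!inE] aj do rewrite fourierB (fourier_indep _ (gB _ _ aj) jS) subr0.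
rewrite sumr_const -[leRHS]mulr_natl ler_wpM2r ?ler_nat //.
by rewrite mulr_ge0 ?sqr_ge0.
Qed.

Lemma expect_ge0 (F : realFieldType) (T : finType) (p : F) (f : {set T} -> F) :
  0 <= p -> p <= 1 -> (forall E, 0 <= f E) -> 0 <= expect p f.
Proof.
move=> p0 p1 f0; apply: sumr_ge0 => E _; rewrite mulr_ge0 //.
by apply: prodr_ge0 => j _; case: ifP; rewrite ?subr_ge0.
Qed.

Lemma le_expect (F : realFieldType) (T : finType) (p : F) (f g : {set T} -> F) :
  0 <= p -> p <= 1 -> (forall E, f E <= g E) -> expect p f <= expect p g.
Proof.
move=> p0 p1 fg; rewrite -subr_ge0 -expectB expect_ge0 // => E; by rewrite subr_ge0.
Qed.

End BiasedCube.

(** * Reed-Muller codes under affine maps *)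

Section ReedMuller.
Import Order.TTheory GRing.Theory Num.Theory.
Import mathcomp.algebra_tactics.ring mathcomp.algebra_tactics.lra.

Lemma inRMP v m (w : word m) :
  reflect (exists2 a : {ffun {set 'I_m} -> bool},
             forall S : {set 'I_m}, v < #|S| -> a S = false &
             forall x, w x = \big[addb/false]_(S : {set 'I_m}) (a S && monom m S x))
          (inRM v m w).
Proof.
apply: (iffP existsP) => [[a /andP[/forallP a0 /forallP aw]]|[a a0 aw]].
  exists a => [S vS|x]; last exact/eqP.
  by have /implyP/(_ vS)/negbTE := a0 S.
exists a; apply/andP; split; apply/forallP => x; last exact/eqP.
by apply/implyP => /a0 ->.
Qed.

Lemma inRM0 v m : inRM v m [ffun=> false].
Proof.
apply/inRMP; exists [ffun=> false] => [S _|x]; rewrite ffunE //.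
by rewrite big1 // => S _; rewrite ffunE.
Qed.

Lemma inRM_add v m (f g : point m -> bool) :
  inRM v m (finfun f) -> inRM v m (finfun g) -> inRM v m [ffun x => f x (+) g x].
Proof.
move=> /inRMP[a a0 af] /inRMP[b b0 bg]; apply/inRMP.
exists [ffun S => a S (+) b S] => [S vS|x]; first by rewrite ffunE a0 ?b0.
move: (af x) (bg x); rewrite !ffunE => -> ->; rewrite -big_split /=.
by apply: eq_bigr => S _; rewrite ffunE andb_addl.
Qed.

Lemma eq_inRM v m (f g : point m -> bool) :
  f =1 g -> inRM v m (finfun f) = inRM v m (finfun g).
Proof. by move=> fg; congr inRM; apply/ffunP => x; rewrite !ffunE. Qed.

Arguments eq_inRM {v m f} g _.

Lemma inRM_sum v m (I : finType) (f : I -> point m -> bool) :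
  (forall i, inRM v m (finfun (f i))) ->
  inRM v m [ffun x => \big[addb/false]_i f i x].
Proof.
move=> fRM; elim: (index_enum I) => [|i s IH].
  by rewrite (eq_inRM (fun=> false)) ?inRM0 // => x; rewrite big_nil.
rewrite (eq_inRM (fun x => f i x (+) \big[addb/false]_(j <- s) f j x)).
  exact: inRM_add.
by move=> x; rewrite big_cons.
Qed.

Lemma inRM_scale v m (b : bool) (f : point m -> bool) :
  (b -> inRM v m (finfun f)) -> inRM v m [ffun x => b && f x].
Proof. by case: b => [|_]; [exact | exact: inRM0]. Qed.

Lemma inRM_monom v m (S : {set 'I_m}) : #|S| <= v -> inRM v m (finfun (monom m S)).
Proof.
move=> Sv; apply/inRMP; exists [ffun U => U == S] => [U|x].
  by rewrite ffunE; case: eqP => // ->; rewrite ltnNge Sv.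
rewrite ffunE (bigD1 S) //= ffunE eqxx /= big1 ?addbF // => U /negPf US.
by rewrite ffunE US.
Qed.

Lemma inRM_leq u v m (w : word m) : u <= v -> inRM u m w -> inRM v m w.
Proof.
move=> uv /inRMP[a a0 aw]; apply/inRMP; exists a => // S vS.
by apply: a0; apply: leq_ltn_trans vS.
Qed.

Lemma monomU1 m (i : 'I_m) (S : {set 'I_m}) x :
  monom m (i |: S) x = x i && monom m S x.
Proof.
apply/forall_inP/andP => [H|[xi /forall_inP H] j].
  split; first by apply: H; rewrite setU11.
  by apply/forall_inP => j jS; apply: H; rewrite setU1r.
by rewrite !inE => /orP[/eqP->|/H].
Qed.

(** Since [x_i ^ 2 = x_i], multiplying by a variable sends the monomial of [S] to that of [i |: S],
    even when [i] is already in [S]. *)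
Lemma inRM_mul_var v m (f : point m -> bool) (i : 'I_m) :
  inRM v m (finfun f) -> inRM v.+1 m [ffun x : point m => x i && f x].
Proof.
move=> /inRMP[a a0 af].
rewrite (eq_inRM (fun x => \big[addb/false]_(S : {set 'I_m}) (a S && monom m (i |: S) x))).
  apply: inRM_sum => S; apply: inRM_scale => aS; apply: inRM_monom.
  rewrite cardsU1 -addn1 addnC leq_add ?leq_b1 // leqNgt; apply/negP => /a0.
  by rewrite aS.
move=> x; move: (af x); rewrite ffunE => ->; rewrite big_distrr /=.
by apply: eq_bigr => S _; rewrite monomU1 andbCA.
Qed.

Definition affine_form m (l : point m -> bool) : Prop :=
  exists c (b : 'I_m -> bool), forall x, l x = c (+) \big[addb/false]_j (b j && x j).

Lemma inRM_mul_affine v m (f l : point m -> bool) :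
  affine_form l -> inRM v m (finfun f) -> inRM v.+1 m [ffun x => l x && f x].
Proof.
move=> [c [b lE]] fRM.
rewrite (eq_inRM (fun x => (c && f x) (+)
    \big[addb/false]_(j < m) (b j && (x j && f x)))).
  apply: inRM_add.
    by apply: inRM_scale => _; apply: inRM_leq fRM.
  by apply: inRM_sum => j; apply: inRM_scale => _; apply: inRM_mul_var.
move=> x; rewrite lE andb_addl big_distrl /=; congr (_ (+) _).
by apply: eq_bigr => j _; rewrite andbA.
Qed.

(** A monomial of degree [d] pulls back to a product of [d] affine forms, and each factor raises the
    degree by at most one. The dimensions may differ, which covers both translations and hyperplane
    embeddings. *)
Lemma inRM_comp_affine v m n (w : word m) (A : point n -> point m) :
  (forall i, affine_form (fun y => A y i)) -> inRM v m w ->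
  inRM v n [ffun y => w (A y)].
Proof.
move=> affA /inRMP[a a0 aw].
have monomA (s : seq 'I_m) : inRM (size s) n [ffun y => all (A y) s].
  elim: s => [|i s IH]; last exact: (inRM_mul_affine (affA i) IH).
  rewrite (eq_inRM (monom n set0)); first by apply: inRM_monom; rewrite cards0.
  by move=> y; apply/esym/forall_inP => j; rewrite inE.
rewrite (eq_inRM (fun y => \big[addb/false]_(S : {set 'I_m}) (a S && monom m S (A y)))).
  apply: inRM_sum => S; apply: inRM_scale => aS.
  rewrite (eq_inRM (fun y => all (A y) (enum S))).
    apply: inRM_leq (monomA _); rewrite -cardE leqNgt; apply/negP => /a0.
    by rewrite aS.
  by move=> y; apply/forall_inP/allP => H j jS; apply: H; rewrite mem_enum in jS *.
by move=> y; rewrite aw.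
Qed.

(** If some coefficient were nonzero, take a smallest such [S] and evaluate at its indicator: only
    monomials of subsets of [S] survive there, and by minimality only that of [S] itself. *)
Lemma monom_free m (a : {ffun {set 'I_m} -> bool}) :
  (forall x, \big[addb/false]_(S : {set 'I_m}) (a S && monom m S x) = false) -> a = [ffun=> false].
Proof.
move=> aE; apply/ffunP => S0; rewrite ffunE; apply/negP => aS0.
have [S aS minS] := arg_minnP (fun S : {set 'I_m} => #|S|) aS0.
have := aE [ffun i => i \in S].
rewrite (bigD1 S) //= aS big1 ?addbF => [|U US].
  by move/negP; apply; apply/forall_inP => i iS; rewrite ffunE.
apply/negP => /andP[aU /forall_inP mU].
have sUS : U \subset S by apply/subsetP => i /mU; rewrite ffunE.
by case/eqP: US; apply/eqP; rewrite eqEcard sUS minS.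
Qed.

Lemma card_subsets_leq v m :
  #|[set S : {set 'I_m} | #|S| <= v]| = \sum_(0 <= k < v.+1) 'C(m, k).
Proof.
elim: v => [|v IH].
  rewrite big_nat1 bin0 (_ : [set _ | _] = [set set0]) ?cards1 //.
  by apply/setP => S; rewrite !inE leqn0 cards_eq0.
rewrite big_nat_recr //= -IH -[X in 'C(X, _)](card_ord m) -card_draws -cardsUI.
rewrite [_ :&: _](_ : _ = set0) ?cards0 ?addn0; last first.
  by apply/setP => S; rewrite !inE; apply/andP => -[Sv /eqP Sv1]; rewrite Sv1 ltnn in Sv.
by congr #|pred_of_set _|; apply/setP => S; rewrite !inE leq_eqVlt ltnS orbC.
Qed.

(** By [monom_free] evaluation is injective, so codewords are counted by their coefficients on the
    sets of size at most [v]. *)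
Lemma card_inRM v m :
  #|[set w : word m | inRM v m w]| = 2 ^ (\sum_(0 <= k < v.+1) 'C(m, k)).
Proof.
pose coefs := [set a : {ffun {set 'I_m} -> bool} |
  a \in pffun_on false (mem [set S : {set 'I_m} | #|S| <= v]) predT].
pose ev (a : {ffun {set 'I_m} -> bool}) : word m :=
  [ffun x => \big[addb/false]_(S : {set 'I_m}) (a S && monom m S x)].
have coefsP (a : {ffun {set 'I_m} -> bool}) :
    reflect (forall S : {set 'I_m}, v < #|S| -> a S = false) (a \in coefs).
  rewrite inE; apply: (iffP pffun_onP) => [[/subsetP aS _] S|aS].
    by rewrite ltnNge; apply: contraNF => aS1; have := aS S; rewrite !inE aS1; apply.
  split=> //; apply/subsetP => S; rewrite !inE => aS1; rewrite leqNgt.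
  by apply/negP => /aS aS0; rewrite aS0 in aS1.
have -> : [set w : word m | inRM v m w] = ev @: coefs.
  apply/setP => w; rewrite inE; apply/inRMP/imsetP => [[a a0 aw]|[a /coefsP a0 ->]].
    by exists a; [apply/coefsP | apply/ffunP => x; rewrite ffunE].
  by exists a => // x; rewrite ffunE.
rewrite card_in_imset => [|a b /coefsP a0 /coefsP b0 eqab].
  rewrite cardsE card_pffun_on card_bool; congr (2 ^ _).
  exact: card_subsets_leq.
have /ffunP ab : [ffun S => a S (+) b S] = [ffun=> false].
  apply: monom_free => x; have /ffunP/(_ x) := eqab; rewrite !ffunE => eqx.
  under eq_bigr do rewrite ffunE andb_addl.
  by rewrite big_split /= eqx addbb.
by apply/ffunP => S; move: (ab S); rewrite !ffunE; case: (a S); case: (b S).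
Qed.
End ReedMuller.

(** * EXIT functions *)

Section Exit.
Import Order.TTheory GRing.Theory Num.Theory.
Import mathcomp.algebra_tactics.ring mathcomp.algebra_tactics.lra.

Definition pt0 m : point m := [ffun=> false].
Definition translate m (i y : point m) : point m := [ffun k => y k (+) i k].

(* The bit at [i] is not determined by the unerased positions other than [i]. *)
Definition exit_event v m (i : point m) (E : {set point m}) : bool :=
  [exists w : word m, [&& inRM v m w, w i &
     [forall j, (j \notin E) && (j != i) ==> ~~ w j]]].

Lemma exit_eventP v m (i : point m) (E : {set point m}) :
  reflect (exists w : word m, [/\ inRM v m w, w i &
             forall j, j \notin E -> j != i -> w j = false])
          (exit_event v i E).
Proof.
apply: (iffP existsP) => -[w]; last first.
  move=> [wRM wi w0]; exists w; apply/and3P; split=> //.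
  by apply/forallP => j; apply/implyP => /andP[jE ji]; rewrite w0.
move=> /and3P[wRM wi /forallP w0]; exists w; split=> // j jE ji.
by have := w0 j; rewrite jE ji => /negbTE.
Qed.

Lemma exit_event_indep v m (i : point m) : indep_of (exit_event v i) i.
Proof.
move=> E; rewrite /exit_event; apply: eq_existsb => w; do 2 congr (_ && _).
by apply: eq_forallb => j; rewrite !inE; case: eqP; rewrite ?andbF.
Qed.

Lemma exit_event_sub v m (i : point m) (E D : {set point m}) :
  E \subset D -> exit_event v i E -> exit_event v i D.
Proof.
move=> /subsetP ED /exit_eventP[w [wRM wi w0]]; apply/exit_eventP; exists w; split=> //.
by move=> j jD; apply: w0; apply: contra jD => /ED.
Qed.

(** The witness codeword pulled back along [A] is again a witness; injectivity keeps the points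
    other than [y] away from [A y]. *)
Lemma exit_event_affine v m n (A : point n -> point m) (y : point n) (E : {set point m}) :
  injective A -> (forall i, affine_form (fun y => A y i)) ->
  exit_event v (A y) E -> exit_event v y (A @^-1: E).
Proof.
move=> injA affA /exit_eventP[w [wRM wi w0]]; apply/exit_eventP.
exists [ffun y => w (A y)]; split; [exact: inRM_comp_affine | by rewrite ffunE |].
move=> j; rewrite inE ffunE => jE ji; apply: w0 => //.
by apply: contra ji => /eqP/injA ->.
Qed.

(** * Translation symmetry and hyperplanes through the origin *)

Lemma translateK m (i : point m) : involutive (translate i).
Proof. by move=> y; apply/ffunP => k; rewrite !ffunE -addbA addbb addbF. Qed.

Lemma coord_sum m (y : point m) (i : 'I_m) :
  y i = \big[addb/false]_j ((j == i) && y j).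
Proof.
rewrite (bigD1 i) //= eqxx big1 ?addbF // => j /negPf -> //.
Qed.

Lemma translate_affine m (i : point m) k : affine_form (fun y => translate i y k).
Proof.
by exists (i k), (fun j => j == k) => y; rewrite ffunE -coord_sum addbC.
Qed.

(** Translations are affine involutions preserving the code, so every position behaves like the
    origin. *)
Lemma exit_event_translate v m (i : point m) (E : {set point m}) :
  exit_event v i E = exit_event v (pt0 m) (translate i @^-1: E).
Proof.
have inj := inv_inj (translateK i); have aff := @translate_affine m i.
apply/idP/idP => [iE|].
  apply: exit_event_affine => //; suff -> : translate i (pt0 m) = i by [].
  by apply/ffunP => k; rewrite !ffunE addFb.
move=> H; have := @exit_event_affine v m m (translate i) i (translate i @^-1: E) inj aff.
suff -> : translate i i = pt0 m.
  move/(_ H); suff -> : translate i @^-1: (translate i @^-1: E) = E by [].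
  by apply/setP => y; rewrite !inE translateK.
by apply/ffunP => k; rewrite !ffunE addbb.
Qed.

Definition dot m (a x : point m) : bool := \big[addb/false]_k (a k && x k).

(* Parametrises the hyperplane [dot a x = 0], [a i = 1], by solving for [x i]. *)
Definition hyperplane n (a : point n.+1) (i : 'I_n.+1) (y : point n) : point n.+1 :=
  [ffun k => if unlift i k is Some j then y j
             else \big[addb/false]_j (a (lift i j) && y j)].

Lemma hyperplane_inj n (a : point n.+1) i : injective (hyperplane a i).
Proof.
move=> x y /ffunP xy; apply/ffunP => j.
by have := xy (lift i j); rewrite !ffunE liftK.
Qed.

Lemma hyperplane_affine n (a : point n.+1) i k :
  affine_form (fun y => hyperplane a i y k).
Proof.
case E: (unlift i k) => [j|].
  exists false, (fun l => l == j) => y; by rewrite ffunE E -coord_sum.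
exists false, (fun l => a (lift i l)) => y; by rewrite ffunE E.
Qed.

Lemma hyperplane0 n (a : point n.+1) i : hyperplane a i (pt0 n) = pt0 n.+1.
Proof.
apply/ffunP => k; rewrite !ffunE; case: unlift => [j|]; first by rewrite ffunE.
by rewrite big1 // => j _; rewrite ffunE andbF.
Qed.

Lemma dot_hyperplane n (a : point n.+1) i y : a i -> dot a (hyperplane a i y) = false.
Proof.
move=> ai; rewrite /dot (bigD1_ord i) //= ai ffunE unlift_none /=.
under [X in _ (+) X]eq_bigr do rewrite ffunE liftK.
by rewrite addbb.
Qed.

(** Translating [a] by a basis vector [e] at a coordinate where [x] is 1 flips [dot a x], so exactly
    half of all [a] qualify. *)
Lemma card_dot n (x : point n.+1) : x != pt0 _ -> #|[set a | dot a x]| = 2 ^ n.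
Proof.
move=> x0; have [k xk] : exists k, x k.
  case: (pickP x) => [k xk|xE]; first by exists k.
  by case/eqP: x0; apply/ffunP => k; rewrite ffunE xE.
pose e : point n.+1 := [ffun j => j == k].
have dotD a : dot (translate e a) x = ~~ dot a x.
  rewrite /dot; under eq_bigr do rewrite !ffunE andb_addl.
  by rewrite big_split /= -coord_sum xk addbT.
have cardC : #|[set a | dot a x]| = #|~: [set a | dot a x]|.
  rewrite -(card_imset _ (inv_inj (translateK e))); apply: eq_card => a.
  apply/imsetP/idP => [[b bx ->]|]; rewrite !inE.
    by rewrite dotD; rewrite inE in bx; rewrite bx.
  by move=> ax; exists (translate e a); rewrite ?translateK // inE dotD.
have := cardsC [set a | dot a x].
rewrite -cardC addnn card_ffun card_bool card_ord expnS mul2n.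
by move=> /double_inj.
Qed.

(** The dimension of the subcode supported on [E], which is the entropy in bits of a uniform
    codeword given its symbols outside [E]. Taking a logarithm of the cardinality replaces linear
    algebra by counting. *)
Definition support_dim v m (E : {set point m}) : nat :=
  logn 2 #|[set w : word m | inRM v m w && [forall j, (j \notin E) ==> ~~ w j]]|.

(** Releasing position [i] either adds no codeword or doubles the subcode, and a doubling is exactly
    a witness of the exit event. *)
Lemma support_dim_step v m (i : point m) (E : {set point m}) :
  support_dim v (i |: E) = support_dim v (E :\ i) + exit_event v i E.
Proof.
rewrite /support_dim; set C1 := [set w | _]; set C0 := [set w | _].
have C1P w : reflect (inRM v m w /\ forall j, j \notin E -> j != i -> w j = false) (w \in C1).
  rewrite inE; apply: (iffP andP) => -[wRM w0]; split=> //.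
    move=> j jE ji; have /forallP/(_ j) := w0.
    by rewrite !inE (negPf ji) jE => /negbTE.
  by apply/forallP => j; apply/implyP; rewrite !inE negb_or => /andP[ji jE]; rewrite w0.
have C0P w : (w \in C0) = (w \in C1) && ~~ w i.
  rewrite !inE -andbA; congr (_ && _).
  apply/forallP/andP => [H|[/forallP H wi] j].
    split; last by have := H i; rewrite !inE eqxx.
    by apply/forallP => j; have := H j; rewrite !inE; case: (j == i); case: (j \in E).
  by have := H j; rewrite !inE; case: eqP => [->|_] /=.
have [/exit_eventP[u [uRM ui u0]]|nex] := boolP (exit_event v i E); last first.
  rewrite addn0; congr (logn 2 _); apply: eq_card => w; rewrite C0P.
  case wC1 : (w \in C1) => //=; apply/esym; apply: contraNN nex => wi.
  by have /C1P[wRM w0] := wC1; apply/exit_eventP; exists w.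
(* Adding the witness [u] exchanges the codewords of [C1] vanishing at [i] with the others. *)
pose add (w : word m) : word m := [ffun x => w x (+) u x].
have addK : involutive add.
  by move=> w; apply/ffunP => x; rewrite !ffunE -addbA addbb addbF.
have addC1 w : w \in C1 -> add w \in C1.
  move=> /C1P[wRM w0]; apply/C1P; split.
    by apply: inRM_add; rewrite ffunK.
  by move=> j jE ji; rewrite ffunE w0 ?u0.
have -> : #|C1| = 2 * #|C0|.
  rewrite -(cardsID C0 C1) mul2n -addnn; congr (_ + _).
    by apply: eq_card => w; rewrite in_setI C0P; case: (w \in C1).
  rewrite -(card_imset C0 (inv_inj addK)); apply: eq_card => w.
  apply/idP/imsetP => [|[z]]; rewrite ?in_setD !C0P.
    case wC1 : (w \in C1) => //=; rewrite andbT negbK => wi.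
    by exists (add w); rewrite ?addK // C0P addC1 //= ffunE wi ui.
  by case/andP=> zC1 zi ->; rewrite addC1 // ffunE ui addbT zi.
have C0_gt0 : 0 < #|C0|.
  apply/card_gt0P; exists [ffun=> false]; rewrite inE inRM0 /=.
  by apply/forallP => j; rewrite ffunE implybT.
by rewrite lognM //= addnC.
Qed.

Lemma support_dim0 v m : support_dim v (set0 : {set point m}) = 0.
Proof.
rewrite /support_dim (_ : [set w | _] = [set [ffun=> false]]) ?cards1 //.
apply/setP => w; rewrite !inE; apply/andP/eqP => [[_ /forallP H]|->].
  by apply/ffunP => x; rewrite ffunE; have := H x; rewrite inE => /negbTE.
by split; [exact: inRM0 | apply/forallP => j; rewrite ffunE implybT].
Qed.

Lemma support_dimT v m :
  support_dim v [set: point m] = \sum_(0 <= k < v.+1) 'C(m, k).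
Proof.
rewrite /support_dim (_ : [set w | _] = [set w | inRM v m w]) ?card_inRM ?pfactorK //.
apply/setP => w; rewrite !inE; case: inRM => //=.
by apply/forallP => j; rewrite inE.
Qed.

Local Open Scope ring_scope.

(** * EXIT probabilities: variance bound, area theorem, monotonicity *)

Definition exit_prob (F : comNzRingType) v m (p : F) : F :=
  expect p (fun E => (exit_event v (pt0 m) E)%:R).

Definition rate (F : fieldType) v m : F :=
  (\sum_(0 <= k < v.+1) 'C(m, k))%N%:R / 2 ^+ m.

Lemma expect_exit_event (F : comNzRingType) v m (i : point m) (p : F) :
  expect p (fun E => (exit_event v i E)%:R) = exit_prob v m p.
Proof.
rewrite /exit_prob.
rewrite -(expect_preim p (fun E => (exit_event v (pt0 m) E)%:R) (inv_inj (translateK i))).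
by apply: eq_expect => E; rewrite exit_event_translate.
Qed.

Lemma exit_prob_ge0 (F : realFieldType) v m (p : F) : 0 <= p -> p <= 1 -> 0 <= exit_prob v m p.
Proof. by move=> p0 p1; apply: expect_ge0 => // E; apply: ler0n. Qed.

Lemma exit_prob_le1 (F : realFieldType) v m (p : F) : 0 <= p -> p <= 1 -> exit_prob v m p <= 1.
Proof.
move=> p0 p1; rewrite -[leRHS](@expect_cst F (point m) p); apply: le_expect => // E.
by rewrite lern1 leq_b1.
Qed.

(** The factor 2 is the ratio between the [2 ^ n.+1] vectors [a] averaged over and the [2 ^ n] of
    them whose hyperplane misses a given nonzero point. *)
Lemma exit_prob_variance (F : realFieldType) v n (p : F) : 0 < p -> p < 1 ->
  exit_prob v n.+1 p * (1 - exit_prob v n.+1 p) <=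
  2 * (exit_prob v n p - exit_prob v n.+1 p).
Proof.
move=> p0 p1; have [p0' p1'] := (ltW p0, ltW p1).
pose f (E : {set point n.+1}) : F := (exit_event v (pt0 n.+1) E)%:R.
(* The zero vector defines no hyperplane; there [g] is [f] itself and contributes nothing to the sum
   of squared gaps. *)
pose g (a : point n.+1) (E : {set point n.+1}) : F :=
  if [pick i | a i] is Some i then (exit_event v (pt0 n) (hyperplane a i @^-1: E))%:R
  else f E.
have fg a i E : f E <= (exit_event v (pt0 n) (hyperplane a i @^-1: E))%:R.
  rewrite /f ler_nat; case fE: exit_event => //.
  rewrite exit_event_affine //; [exact: hyperplane_inj | exact: hyperplane_affine |].
  by rewrite hyperplane0.
have sqb (b : bool) : (b%:R : F) ^+ 2 = b%:R by case: b; rewrite ?expr1n ?expr0n.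
have gE a i : expect p (fun E => (exit_event v (pt0 n) (hyperplane a i @^-1: E))%:R) =
    exit_prob v n p.
  by rewrite (expect_preim p (fun E => (exit_event v (pt0 n) E)%:R)) //; apply: hyperplane_inj.
have hg : exit_prob v n.+1 p <= exit_prob v n p.
  (* Any embedding serves for this comparison; this one parametrises the hyperplane where coordinate
     [ord0] vanishes. *)
  rewrite -(gE (pt0 n.+1) ord0); apply: le_expect => // E; exact: fg.
have gB a j : j \in [set x | dot a x] -> indep_of (g a) j.
  rewrite inE => aj E; rewrite /g; case: pickP => [i ai|a0]; last first.
    by move: aj; rewrite /dot big1 // => k _; rewrite a0.
  (* A point with [dot a j] true is not in the image of the hyperplane, so changing [E] at [j]
     leaves the preimage unchanged. *)
  congr (nat_of_bool (exit_event _ _ _))%:R; apply/setP => y; rewrite !inE.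
  by case: eqP => // yj; rewrite -yj dot_hyperplane in aj.
have fB j : indep_of f j \/ (2 ^ n <= #|[set a | j \in [set x | dot a x]]|)%N.
  (* The origin lies on every hyperplane, but [f] disregards the erasure of its own bit. *)
  have [->|j0] := eqVneq j (pt0 n.+1).
    by left => E; rewrite /f exit_event_indep.
  right; rewrite -(card_dot j0); apply: subset_leq_card.
  by apply/subsetP => a; rewrite !inE.
have le_gap a : expect p (fun E => (f E - g a E) ^+ 2) <= exit_prob v n p - exit_prob v n.+1 p.
  rewrite /g; case: pickP => [i ai|_].
    rewrite -(gE a i) -expectB; apply: le_expect => // E.
    have := fg a i E; rewrite /f.
    by case: exit_event; case: exit_event;
      rewrite ?ler10 // ?subrr ?sub0r ?subr0 ?expr0n ?sqrrN ?expr1n.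
  rewrite (eq_expect _ (g := fun=> 0)) ?expect_cst ?subr_ge0 // => E.
  by rewrite subrr expr0n.
have fE : expect p (fun E => f E ^+ 2) = exit_prob v n.+1 p.
  by apply: eq_expect => E; rewrite sqb.
have /le_trans := variance_le p0 p1 gB fB.
rewrite fE -/(exit_prob v n.+1 p) => /(_ _ (ler_sum _ (fun a _ => le_gap a))).
rewrite sumr_const card_ffun card_bool card_ord -[leRHS]mulr_natl expnSr natrM -mulrA.
rewrite ler_pM2l ?ltr0n ?expn_gt0 // => var.
by rewrite mulrBr mulr1 -expr2.
Qed.

(** The expected conditional entropy per code bit, as a polynomial in the erasure probability. It
    serves as an antiderivative of the EXIT function, so that areas need no integration. *)
Definition area_poly (F : fieldType) v m : {poly F} :=
  (2 ^- m) *: expect 'X (fun E : {set point m} => ((support_dim v E)%:R)%:P).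

Lemma area_poly0 (F : fieldType) v m : (area_poly F v m).[0] = 0.
Proof. by rewrite hornerZ horner_expect expect0 support_dim0 mulr0. Qed.

Lemma area_poly1 (F : fieldType) v m : (area_poly F v m).[1] = rate F v m.
Proof. by rewrite hornerZ horner_expect expect1 support_dimT mulrC. Qed.

(* The area theorem: the EXIT function integrates to the rate. *)
Lemma deriv_area_poly (F : realFieldType) v m (p : F) :
  (area_poly F v m)^`().[p] = exit_prob v m p.
Proof.
rewrite derivZ hornerZ deriv_expect horner_sum.
under eq_bigr => j _.
  rewrite horner_expect (eq_expect _ (g := fun E => (exit_event v j E)%:R)) => [|E].
    rewrite expect_exit_event; over.
  by rewrite support_dim_step natrD addrC addKr.
rewrite sumr_const card_ffun card_bool card_ord -[exit_prob _ _ _ *+ _]mulr_natl natrX mulKf //.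
by rewrite expf_neq0 // pnatr_eq0.
Qed.

(** By Russo's formula the derivative is a sum of influences, which are nonnegative because further
    erasures can only make the exit event true. *)
Lemma exit_prob_homo (F : rcfType) v m (p q : F) :
  0 <= p -> p <= q -> q <= 1 -> exit_prob v m p <= exit_prob v m q.
Proof.
move=> p0 pq q1; rewrite /exit_prob -(horner_expect p) -(horner_expect q).
apply: (@ler_hornerW F 0 1); rewrite ?in_itv /= ?p0 ?q1 ?(le_trans p0) ?(le_trans pq) //.
move=> x; rewrite in_itv /= => /andP[x0 x1]; rewrite deriv_expect horner_sum.
apply: sumr_ge0 => j _; rewrite horner_expect.
apply: expect_ge0 => [||E]; rewrite ?(ltW x0) ?(ltW x1) // subr_ge0 ler_nat.
case jE: (exit_event v (pt0 m) (E :\ j)) => //; rewrite (exit_event_sub _ jE) //.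
by apply: subset_trans (subsetUr _ _); rewrite subD1set.
Qed.

(* For [eta] the EXIT probability at [p], the polynomial
   [2 (G - H) - eta (x - H)] built from the areas [G] and [H] of lengths
   [2 ^ n] and [2 ^ n.+1] is nondecreasing on [[p, 1]]. *)
Lemma exit_prob_bound (F : rcfType) v n (p : F) : 0 <= p -> p <= 1 ->
  exit_prob v n.+1 p * (1 - p - rate F v n.+1) <= 2 * (rate F v n - rate F v n.+1).
Proof.
move=> p0 p1; set eta := exit_prob v n.+1 p.
have eta0 : 0 <= eta by apply: exit_prob_ge0.
have dG := @deriv_area_poly F v n; have dH := @deriv_area_poly F v n.+1.
have G0 := area_poly0 F v n; have H0 := area_poly0 F v n.+1.
have G1 := area_poly1 F v n; have H1 := area_poly1 F v n.+1.
move: (area_poly F v n) (area_poly F v n.+1) dG dH G0 H0 G1 H1.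
move=> G H dG dH G0 H0 G1 H1.
have var (x : F) : 0 < x -> x < 1 -> exit_prob v n.+1 x * (1 - exit_prob v n.+1 x) <=
  2 * (exit_prob v n x - exit_prob v n.+1 x) by apply: exit_prob_variance.
have h01 (x : F) : 0 < x -> x < 1 -> 0 <= exit_prob v n.+1 x <= 1.
  by move=> x0 x1; rewrite exit_prob_ge0 ?exit_prob_le1 ?ltW.
have Hp : 0 <= H.[p].
  rewrite -H0; apply: (@ler_hornerW F 0 1); rewrite ?in_itv /= ?lexx ?ler01 ?p0 //.
  move=> x; rewrite in_itv /= => /andP[x0 x1]; rewrite dH.
  by have /andP[] := h01 x x0 x1.
(* The variance bound forces the derivative of [G - H] to be nonnegative. *)
have GHp : G.[0] - H.[0] <= G.[p] - H.[p].
  rewrite -!hornerN -!hornerD.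
  apply: (@ler_hornerW F 0 1); rewrite ?in_itv /= ?lexx ?ler01 ?p0 //.
  move=> x; rewrite in_itv /= => /andP[x0 x1]; rewrite derivB hornerD hornerN dG dH.
  have := var x x0 x1; have /andP[] := h01 x x0 x1; nra.
pose Phi := 2%:P * (G - H) - eta%:P * ('X - H).
have : Phi.[p] <= Phi.[1].
  apply: (@ler_hornerW F p 1); rewrite ?in_itv /= ?lexx ?p1 //.
  move=> x; rewrite in_itv /= => /andP[px x1].
  have x0 : 0 < x by apply: le_lt_trans px.
  have -> : Phi^`() = 2%:P * (G^`() - H^`()) - eta%:P * (1 - H^`()).
    by rewrite /Phi !derivE; ring.
  rewrite !hornerE dG dH.
  have := var x x0 x1; have /andP[] := h01 x x0 x1.
  have : eta <= exit_prob v n.+1 x by apply: exit_prob_homo => //; apply: ltW.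
  (* With [h] the longer code's EXIT probability at [x], the derivative of [Phi] is at least
     [h * (1 - h) - eta * (1 - h)], nonnegative since [eta <= h <= 1]. *)
  nra.
(* Nonnegativity of [G - H] and [H] at [p] gives [Phi.[p] >= - eta * p], to be compared with the
   value at 1. *)
rewrite /Phi !hornerE G1 H1; rewrite G0 H0 in GHp.
move: Hp GHp; nra.
Qed.

End Exit.

(** * Bit error probability *)

Section Bridge.
Import Order.TTheory GRing.Theory Num.Theory.
Import mathcomp.algebra_tactics.ring mathcomp.algebra_tactics.lra.

(** * Binomial estimates *)

Lemma sum_bin_rec v n :
  \sum_(0 <= k < v.+1) 'C(n.+1, k) + 'C(n, v) = (\sum_(0 <= k < v.+1) 'C(n, k)).*2.
Proof.
elim: v => [|v IH]; first by rewrite !big_nat1 !bin0.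
rewrite big_nat_recr //= [in RHS]big_nat_recr //= binS doubleD -IH; lia.
Qed.

(** The square is a single term of Vandermonde's sum for the central coefficient. *)
Lemma sqr_bin_le n k : 'C(n, k) ^ 2 <= 'C(n.*2, n).
Proof.
have [kn|nk] := leqP k n; last by rewrite bin_small.
rewrite -addnn -binomial.Vandermonde (bigD1 (Ordinal (kn : k < n.+1))) //= bin_sub // -mulnn.
exact: leq_addr.
Qed.

Lemma central_bin_rec n : n.+1 * 'C(n.+1.*2, n.+1) = (n.*2.+1).*2 * 'C(n.*2, n).
Proof.
have E1 := mul_bin_diag n.*2.+2 n; have E2 := mul_bin_diag n.*2.+1 n.
have E3 : 'C(n.*2.+1, n) = 'C(n.*2.+1, n.+1).
  by rewrite -bin_sub; [congr 'C(_, _); lia | lia].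
rewrite doubleS -E1 /= E3 -!doubleS -!mul2n -!mulnA; congr (2 * _).
by rewrite mul2n -E2.
Qed.

(** By [central_bin_rec] the induction step reduces to [(2n+3)(2n+1) <= (2n+2)^2]. *)
Lemma central_bin_le n : n.*2.+1 * 'C(n.*2, n) ^ 2 <= 16 ^ n.
Proof.
elim: n => [//|n IH].
rewrite -(leq_pmul2l (isT : 0 < n.+1 ^ 2)) mulnCA -expnMn central_bin_rec (expnS 16).
have -> : (n.*2.+1).*2 * 'C(n.*2, n) = 2 * (n.*2.+1 * 'C(n.*2, n)) by lia.
have K : (n.+1).*2.+1 * n.*2.+1 * 4 <= n.+1 ^ 2 * 16 by rewrite -!mul2n; lia.
rewrite [leqRHS]mulnA; apply: leq_trans (leq_mul K IH); apply: eq_leq.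
rewrite !expnMn; set c := 'C(_, _); set x := n.*2.+1; set y := n.+1.*2.+1.
by rewrite -!mulnn; lia.
Qed.

(** A fourth power arises from squaring twice: once to reach a central coefficient whatever the
    parity of [n], once to bound that coefficient. It makes ['C(n, k) / 2 ^ n] vanish uniformly in
    [k]. *)
Lemma bin_pow4_le n k : n.*2.+1 * 'C(n, k) ^ 4 <= 16 ^ n.
Proof.
apply: leq_trans (central_bin_le n); rewrite leq_mul2l /= (expnM _ 2 2).
by rewrite leq_exp2r // sqr_bin_le.
Qed.

Local Open Scope ring_scope.

Lemma rate_diff (F : numFieldType) v n :
  rate F v n - rate F v n.+1 = ('C(n, v))%:R / 2 ^+ n.+1.
Proof.
have E := congr1 (fun k : nat => k%:R : F) (sum_bin_rec v n).
rewrite /= natrD -mul2n natrM in E.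
have p2 : (2 ^+ n : F) != 0 by rewrite expf_neq0 // pnatr_eq0.
rewrite /rate exprS; set a := (\sum_(0 <= k < v.+1) 'C(n.+1, k))%N%:R in E *.
set b := (\sum_(0 <= k < v.+1) 'C(n, k))%N%:R in E *.
have -> : b = (a + ('C(n, v))%:R) / 2 by rewrite E; field.
by field.
Qed.

Lemma bin_frac_pow4_le (F : numFieldType) n k :
  (('C(n, k))%:R / 2 ^+ n) ^+ 4 <= (n.*2.+1)%:R^-1 :> F.
Proof.
rewrite expr_div_n -exprM mulnC exprM (_ : 2 ^+ 4 = 16%:R) -?natrX //.
rewrite ler_pdivrMr ?ltr0n ?expn_gt0 //.
by rewrite ler_pdivlMl ?ltr0n // -?natrX -natrM ler_nat bin_pow4_le.
Qed.

(** * Comparison of the bit error with the EXIT probability *)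

Lemma ambiguous_exit v m (X : word m) (E : {set point m}) (i : point m) :
  inRM v m X -> ambiguous v m X E i -> exit_event v i E.
Proof.
move=> XRM /existsP[X' /and3P[X'RM X'i /forallP X'E]]; apply/exit_eventP.
(* By linearity the sum of two codewords agreeing off [E] is a codeword that vanishes there. *)
exists [ffun x => X' x (+) X x]; split; first by apply: inRM_add; rewrite ffunK.
  by rewrite ffunE; case: (X' i) (X i) X'i => [] [].
move=> j jE _; rewrite ffunE; have := X'E j; rewrite jE => /eqP ->; exact: addbb.
Qed.

Lemma erasure_probE m (p : R) (E : {set point m}) : erasure_prob m p E = mu p E.
Proof.
rewrite /erasure_prob /mu (bigID (mem E)) /= RmultE !RpowE; congr (_ * _).
  by rewrite (eq_bigr (fun=> p)) ?prodr_const // => j ->.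
rewrite (eq_bigr (fun=> 1 - p)) => [|j /negPf -> //].
by rewrite prodr_const cardsT -(cardsC E) addKn; congr (_ ^+ _); apply: eq_card => j; rewrite !inE.
Qed.

Lemma RM_PbE v m (p : R) : RM_Pb v m p =
  (2 ^+ m)^-1 * \sum_i \sum_(X : word m | inRM v m X)
     (#|[pred w : word m | inRM v m w]|%:R)^-1 *
       expect p (fun E => (ambiguous v m X E i)%:R).
Proof.
rewrite /RM_Pb RmultE RinvE RpowE; congr (_ * _); apply: eq_bigr => i _.
apply: eq_bigr => X _; rewrite /expect mulr_sumr; apply: eq_bigr => E _.
rewrite erasure_probE /RM_card INRE mulrA; by case: ambiguous.
Qed.

Lemma RM_Pb_le_exit v m (p : R) : 0 <= p -> p <= 1 ->
  0 <= RM_Pb v m p <= exit_prob v m p.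
Proof.
move=> p0 p1; rewrite RM_PbE.
have N0 : 0 <= (#|[pred w : word m | inRM v m w]|%:R : R)^-1 by rewrite invr_ge0.
apply/andP; split.
  rewrite mulr_ge0 ?invr_ge0 ?exprn_ge0 // sumr_ge0 // => i _; rewrite sumr_ge0 // => X _.
  by rewrite mulr_ge0 // expect_ge0.
rewrite mulrC ler_pdivrMr ?exprn_gt0 //.
have -> : exit_prob v m p * 2 ^+ m = \sum_(i : point m) exit_prob v m p.
  by rewrite sumr_const card_ffun card_bool card_ord -natrX mulr_natr.
apply: ler_sum => i _; rewrite -(expect_exit_event _ i).
set e := expect _ _.
have -> : e = \sum_(X : word m | inRM v m X) (#|[pred w : word m | inRM v m w]|%:R)^-1 * e.
  rewrite sumr_const -[RHS]mulr_natl mulVKf // pnatr_eq0 -lt0n.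
  by apply/card_gt0P; exists [ffun=> false]; apply: inRM0.
apply: ler_sum => X XRM; apply: ler_wpM2l => //; apply: le_expect => // E.
rewrite ler_nat; case A: ambiguous => //.
by rewrite (ambiguous_exit XRM A).
Qed.

Lemma RM_rateE v m : RM_rate v m = rate R v m.
Proof. by rewrite /RM_rate RdivE INRE RpowE. Qed.

Lemma RM_Pb_bound v n (p : R) : 0 <= p -> p <= 1 -> 0 < 1 - p - RM_rate v n.+1 ->
  RM_Pb v n.+1 p <= ('C(n, v))%:R / 2 ^+ n / (1 - p - RM_rate v n.+1).
Proof.
move=> p0 p1 d0; have /andP[_ /le_trans] := RM_Pb_le_exit v n.+1 p0 p1; apply.
rewrite ler_pdivlMr // RM_rateE; apply: le_trans (exit_prob_bound _ _ p0 p1) _.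
rewrite rate_diff exprS le_eqVlt; apply/orP; left; apply/eqP.
by field; rewrite expf_neq0 // pnatr_eq0.
Qed.

End Bridge.

(** * Vanishing bit error below capacity *)

Section Capacity.
Local Open Scope R_scope.

Lemma RM_Pb_cv (v : nat -> nat) (r p : R) :
  Un_cv (fun m => RM_rate (v m) m) r -> 0 <= p -> p < 1 - r ->
  Un_cv (fun m => RM_Pb (v m) m p) 0.
Proof.
move=> cvr p0 pr eps eps0; set d := (1 - r - p) / 2.
have d0 : 0 < d by rewrite /d; lra.
have r0 m : 0 <= RM_rate (v m) m.
  rewrite /RM_rate; apply: Rmult_le_pos; first exact: pos_INR.
  by apply/Rlt_le/Rinv_0_lt_compat/pow_lt; lra.
(* A limit of rates is nonnegative, and this yields [p <= 1] below. *)
have r_ge0 : 0 <= r.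
  apply: Rnot_lt_le => rn; have [N HN] := cvr (- r) ltac:(lra).
  by have := HN N (le_n N); have := r0 N; rewrite /Rdist; split_Rabs; lra.
have [N1 HN1] := cvr d d0.
have ed4 : 0 < (eps * d) ^ 4 by apply: pow_lt; nra.
(* Beyond [N2] the fourth-power estimate brings the binomial weight below [eps * d], while [d], half
   the gap to capacity, eventually bounds the denominator of [RM_Pb_bound] from below. *)
have [N2 HN2] := INR_unbounded (/ (eps * d) ^ 4).
exists (S (N1 + N2)) => m Hm.
case: m Hm => [|n] Hm; first by lia.
have HN : (n.+1 >= N1)%coq_nat by lia.
have := HN1 _ HN; rewrite /Rdist => Hr.
have dd : d <= 1 - p - RM_rate (v n.+1) n.+1 by rewrite /d in Hr *; split_Rabs; lra.
have p1 : p <= 1 by lra.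
have [/RleP p0' /RleP p1'] := conj p0 p1.
have Pb0 : 0 <= RM_Pb (v n.+1) n.+1 p.
  by have /andP[H _] := RM_Pb_le_exit (v n.+1) n.+1 p0' p1'; apply/RleP.
have Pb1 : RM_Pb (v n.+1) n.+1 p <=
    INR 'C(n, v n.+1) / 2 ^ n / (1 - p - RM_rate (v n.+1) n.+1).
  have /RltP d0' := Rlt_le_trans _ _ _ d0 dd.
  have /RleP := RM_Pb_bound p0' p1' d0'.
  by rewrite INRE !RdivE RpowE.
set c := INR _ / _ in Pb1.
have c0 : 0 <= c.
  by apply: Rmult_le_pos; [exact: pos_INR | apply/Rlt_le/Rinv_0_lt_compat/pow_lt; lra].
have c4 : c ^ 4 <= / INR (n.*2.+1).
  have /RleP := bin_frac_pow4_le R n (v n.+1).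
  by rewrite /c INRE RdivE !RpowE INRE RinvE.
have ced : c < eps * d.
  apply: Rnot_le_lt => H.
  have : (eps * d) ^ 4 <= c ^ 4 by apply: pow_incr; split=> //; nra.
  have nN : INR N2 < INR (n.*2.+1) by apply: lt_INR; lia.
  have : / INR (n.*2.+1) < (eps * d) ^ 4.
    rewrite -[X in _ < X]Rinv_inv; apply: Rinv_lt_contravar; last lra.
    apply: Rmult_lt_0_compat; first exact: Rinv_0_lt_compat.
    by apply: lt_0_INR; lia.
  lra.
rewrite /Rdist Rminus_0_r Rabs_pos_eq //; apply: (Rle_lt_trans _ _ _ Pb1).
apply: (Rle_lt_trans _ (c / d)).
  by apply: Rmult_le_compat_l => //; apply: Rinv_le_contravar.
by apply: (Rmult_lt_reg_r d) => //; rewrite /Rdiv Rmult_assoc Rinv_l; lra.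
Qed.
End Capacity.

From Coquelicot Require Import Coquelicot.

(** * The Gaussian integral *)

Section Gaussian.
Local Open Scope R_scope.

Definition expsq (x : R) : R := exp (- x ^ 2 / 2).

Lemma is_derive_expsq x : is_derive expsq x (- x * expsq x).
Proof. by rewrite /expsq; auto_derive => //; rewrite /Rdiv /=; field. Qed.

Lemma continuous_expsq x : continuous expsq x.
Proof. by apply: ex_derive_continuous; eexists; apply: is_derive_expsq. Qed.

Lemma expsq_gt0 x : 0 < expsq x.
Proof. exact: exp_pos. Qed.

(** From [1 + y <= exp y]; this polynomial decay replaces every finer Gaussian tail estimate. *)
Lemma expsq_le x : expsq x <= / (1 + x ^ 2 / 2).
Proof.
have x2 := pow2_ge_0 x.
rewrite /expsq (_ : - x ^ 2 / 2 = - (x ^ 2 / 2)); last by field.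
rewrite exp_Ropp; apply: Rinv_le_contravar; first lra.
exact: exp_ineq1_le.
Qed.

Lemma expsq_le1 x : expsq x <= 1.
Proof.
have x2 := pow2_ge_0 x; apply: (Rle_trans _ _ _ (expsq_le x)).
by rewrite -[X in _ <= X]Rinv_1; apply: Rinv_le_contravar; lra.
Qed.

Lemma ex_RInt_expsq a b : ex_RInt expsq a b.
Proof. by apply: ex_RInt_continuous => x _; apply: continuous_expsq. Qed.

Lemma is_derive_RInt_expsq x : is_derive (fun z => RInt expsq 0 z) x (expsq x).
Proof.
apply: (is_derive_RInt expsq (fun z => RInt expsq 0 z) 0).
  by apply: filter_forall => z; apply: RInt_correct; apply: ex_RInt_expsq.
exact: continuous_expsq.
Qed.

(** Its integral over [u] in [[0, 1]] is built to have minus the derivative in [x] of the squared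
    Gaussian integral, the classical evaluation by differentiating under the integral sign. *)
Definition polar_kernel (x u : R) : R := 2 * exp (- x ^ 2 * (1 + u ^ 2) / 2) / (1 + u ^ 2).

Lemma is_derive_polar_kernel x u :
  is_derive (fun z => polar_kernel z u) x (- 2 * x * exp (- x ^ 2 * (1 + u ^ 2) / 2)).
Proof.
have u2 := pow2_ge_0 u.
rewrite /polar_kernel; auto_derive => //; rewrite /Rdiv /=; field; nra.
Qed.

Lemma ex_RInt_polar_kernel x a b : ex_RInt (polar_kernel x) a b.
Proof.
apply: ex_RInt_continuous => u _; apply: ex_derive_continuous.
have u2 := pow2_ge_0 u.
by rewrite /polar_kernel; auto_derive; nra.
Qed.

Lemma is_derive_RInt_polar_kernel x :
  is_derive (fun z => RInt (polar_kernel z) 0 1) x (- 2 * expsq x * RInt expsq 0 x).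
Proof.
have -> : - 2 * expsq x * RInt expsq 0 x =
    RInt (fun u => Derive (fun z => polar_kernel z u) x) 0 1.
  (* The substitution [x * y] turns the integral over [[0, 1]] into one over [[0, x]]. *)
  have E : RInt (fun y => scal x (expsq (x * y + 0))) 0 1 = RInt expsq 0 x.
    rewrite RInt_comp_lin; last exact: ex_RInt_expsq.
    by congr RInt; ring.
  rewrite -E -[RHS](RInt_ext (fun y => scal (- 2 * expsq x) (scal x (expsq (x * y + 0))))).
    rewrite [RHS]RInt_scal; first by [].
    apply: (@ex_RInt_continuous R_CompleteNormedModule) => z _.
    apply: ex_derive_continuous.
    by rewrite /scal /= /mult /= /expsq; auto_derive.
  move=> u _; rewrite (is_derive_unique _ _ _ (is_derive_polar_kernel x u)).
  rewrite /scal /= /mult /= /expsq.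
  have -> : exp (- x ^ 2 * (1 + u ^ 2) / 2) = exp (- x ^ 2 / 2) * exp (- (x * u + 0) ^ 2 / 2).
    by rewrite -exp_plus; congr exp; field.
  ring.
apply: is_derive_RInt_param.
- by apply: filter_forall => z u _; eexists; apply: is_derive_polar_kernel.
- move=> u _; apply: (@continuity_2d_pt_ext
    (fun x u => (- 2 * x) * exp (- (x * x) * (1 + u * u) * / 2))).
    move=> y w; rewrite (is_derive_unique _ _ _ (is_derive_polar_kernel y w)).
    by congr (_ * exp _); field.
  apply: continuity_2d_pt_mult.
    by apply: continuity_2d_pt_mult; [exact: continuity_2d_pt_const | exact: continuity_2d_pt_id1].
  apply: (@continuity_1d_2d_pt_comp exp (fun x u => - (x * x) * (1 + u * u) * / 2)).
    exact/derivable_continuous_pt/derivable_pt_exp.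
  apply: continuity_2d_pt_mult; last exact: continuity_2d_pt_const.
  apply: continuity_2d_pt_mult.
    by apply: continuity_2d_pt_opp; apply: continuity_2d_pt_mult; apply: continuity_2d_pt_id1.
  apply: continuity_2d_pt_plus; first exact: continuity_2d_pt_const.
  by apply: continuity_2d_pt_mult; apply: continuity_2d_pt_id2.
- by apply: filter_forall => z; apply: ex_RInt_polar_kernel.
Qed.

(** The left side has zero derivative, and at [x = 0] it is the integral of [2 / (1 + u ^ 2)] over
    [[0, 1]], that is [2 * atan 1]. *)
Lemma gauss_integral_identity x : 0 <= x ->
  (RInt expsq 0 x) ^ 2 + RInt (polar_kernel x) 0 1 = PI / 2.
Proof.
move=> x0; pose f z := (RInt expsq 0 z) ^ 2 + RInt (polar_kernel z) 0 1.
have f0 : f 0 = PI / 2.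
  rewrite /f RInt_point /zero /= Rmult_0_l Rplus_0_l.
  have -> : PI / 2 = minus (2 * atan 1) (2 * atan 0).
    by rewrite atan_1 atan_0 /minus /plus /opp /=; field.
  apply: is_RInt_unique; apply: (is_RInt_ext (fun u => 2 * / (1 + u²))).
    move=> u _; rewrite /polar_kernel (_ : - 0 ^ 2 * (1 + u ^ 2) / 2 = 0); last by field.
    by rewrite exp_0 /Rsqr /=; field; nra.
  apply: (is_RInt_derive (fun u => 2 * atan u) (fun u => 2 * / (1 + u²))) => u _.
    by apply: is_derive_scal; apply: is_derive_atan.
  apply: ex_derive_continuous; rewrite /Rsqr; auto_derive; nra.
case: x0 => [x0|<-] //; rewrite -f0; apply/esym/(@eq_is_derive _ f) => // z _.
have -> : @zero R_NormedModule =
    2 * expsq z * (RInt expsq 0 z) ^ 1 + (- 2 * expsq z * RInt expsq 0 z).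
  by rewrite /zero /=; ring.
apply: is_derive_plus; last exact: is_derive_RInt_polar_kernel.
have := is_derive_pow (fun z => RInt expsq 0 z) 2 z (expsq z) (is_derive_RInt_expsq z).
by rewrite /=; apply.
Qed.

Lemma RInt_expsq_bounds x : 0 <= x ->
  PI / 2 - 2 * / (1 + x ^ 2 / 2) <= (RInt expsq 0 x) ^ 2 <= PI / 2.
Proof.
move=> x0; have := gauss_integral_identity x0.
have K u : 0 <= polar_kernel x u <= 2 * expsq x.
  have u2 := pow2_ge_0 u; rewrite /polar_kernel.
  have -> : - x ^ 2 * (1 + u ^ 2) / 2 = - x ^ 2 / 2 + - (x * u) ^ 2 / 2 by field.
  rewrite exp_plus -!/(expsq _).
  have xe := expsq_gt0 x; have ue := expsq_gt0 (x * u).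
  have u1 := expsq_le1 (x * u).
  have i0 : 0 < / (1 + u ^ 2) by apply: Rinv_0_lt_compat; lra.
  have i1 : / (1 + u ^ 2) <= 1 by rewrite -Rinv_1; apply: Rinv_le_contravar; lra.
  rewrite /Rdiv; split; first by apply: Rmult_le_pos; nra.
  have : expsq (x * u) * / (1 + u ^ 2) <= 1 by nra.
  nra.
have J0 : 0 <= RInt (polar_kernel x) 0 1.
  by apply: RInt_ge_0 => [||u _]; [lra | exact: ex_RInt_polar_kernel | case: (K u)].
have J1 : RInt (polar_kernel x) 0 1 <= 2 * expsq x.
  have -> : 2 * expsq x = RInt (fun _ => 2 * expsq x) 0 1.
    by rewrite RInt_const /scal /= /mult /=; ring.
  apply: RInt_le => [|||u _]; [lra | exact: ex_RInt_polar_kernel | exact: ex_RInt_const |].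
  by case: (K u).
have := expsq_le x; lra.
Qed.
End Gaussian.

(** * The heat equation and random walks *)

Section CLT.
Local Open Scope R_scope.

(** The standard normal distribution function minus 1/2: an odd function given by a proper
    integral. *)
Definition gauss_area (z : R) : R := / sqrt (2 * PI) * RInt expsq 0 z.

Lemma gaussE x : gauss x = / sqrt (2 * PI) * expsq x.
Proof. by []. Qed.

Lemma gauss_cst_gt0 : 0 < / sqrt (2 * PI).
Proof. by apply/Rinv_0_lt_compat/sqrt_lt_R0; have := PI_RGT_0; lra. Qed.

Lemma gauss_cst_sqr : (/ sqrt (2 * PI)) ^ 2 = / (2 * PI).
Proof.
by rewrite pow_inv /= Rmult_1_r sqrt_sqrt //; have := PI_RGT_0; lra.
Qed.

Lemma gauss_cst_le1 : / sqrt (2 * PI) <= 1.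
Proof.
have c0 := gauss_cst_gt0; have c2 := gauss_cst_sqr.
have : / (2 * PI) <= 1.
  by rewrite -[X in _ <= X]Rinv_1; apply: Rinv_le_contravar; have := PI2_3_2; lra.
nra.
Qed.

Lemma gauss_ge0 x : 0 <= gauss x.
Proof.
by rewrite gaussE; apply: Rmult_le_pos; [have := gauss_cst_gt0 | have := expsq_gt0 x]; lra.
Qed.

Lemma gauss_le1 x : gauss x <= 1.
Proof.
rewrite gaussE; have := gauss_cst_gt0; have := gauss_cst_le1.
have := expsq_gt0 x; have := expsq_le1 x; nra.
Qed.

Lemma is_derive_gauss z : is_derive gauss z (- z * gauss z).
Proof.
have -> : - z * gauss z = / sqrt (2 * PI) * (- z * expsq z) by rewrite gaussE; ring.
by apply: is_derive_scal; apply: is_derive_expsq.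
Qed.

(** The quantity is minus the second derivative of [gauss]; [expsq_le] absorbs the factor
    [z ^ 2]. *)
Lemma gauss_deriv2_bound z : Rabs ((1 - z ^ 2) * gauss z) <= 2.
Proof.
rewrite gaussE; have c0 := gauss_cst_gt0; have c1 := gauss_cst_le1.
have e0 := expsq_gt0 z; have e1 := expsq_le1 z; have z2 := pow2_ge_0 z.
have ze : z ^ 2 * expsq z <= 2.
  apply: (Rle_trans _ (z ^ 2 * / (1 + z ^ 2 / 2))).
    by apply: Rmult_le_compat_l => //; apply: expsq_le.
  apply: (Rmult_le_reg_r (1 + z ^ 2 / 2)); first lra.
  by rewrite Rmult_assoc Rinv_l; lra.
rewrite (_ : (1 - _) * _ = / sqrt (2 * PI) * ((1 - z ^ 2) * expsq z)); last by ring.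
rewrite Rabs_mult (Rabs_pos_eq (/ _)); last lra.
have : Rabs ((1 - z ^ 2) * expsq z) <= 2 by apply: Rabs_le; nra.
have := Rabs_pos ((1 - z ^ 2) * expsq z); nra.
Qed.

Lemma is_derive_gauss_area z : is_derive gauss_area z (gauss z).
Proof. by apply: is_derive_scal; apply: is_derive_RInt_expsq. Qed.

Lemma continuity_gauss_area z : continuity_pt gauss_area z.
Proof.
apply/continuity_pt_filterlim/(@ex_derive_continuous R_AbsRing R_NormedModule).
by eexists; apply: is_derive_gauss_area.
Qed.

Lemma gauss_area_mvt z w : exists c, gauss_area w - gauss_area z = gauss c * (w - z).
Proof.
have [||c [_ ->]] := @MVT_gen gauss_area z w gauss; last by exists c.
- by move=> x _; apply: is_derive_gauss_area.
- by move=> x _; apply: continuity_gauss_area.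
Qed.

Lemma gauss_area_homo z w : z <= w -> gauss_area z <= gauss_area w.
Proof.
move=> zw; have [c] := gauss_area_mvt z w; have := gauss_ge0 c; nra.
Qed.

Lemma gauss_area_lip z w : Rabs (gauss_area w - gauss_area z) <= Rabs (w - z).
Proof.
have [c ->] := gauss_area_mvt z w; rewrite Rabs_mult Rabs_pos_eq; last exact: gauss_ge0.
have := gauss_le1 c; have := gauss_ge0 c; have := Rabs_pos (w - z); nra.
Qed.

Lemma gauss_area_opp z : gauss_area (- z) = - gauss_area z.
Proof.
rewrite /gauss_area.
have -> : RInt expsq 0 (- z) = RInt (fun y => scal (-1) (expsq (-1 * y + 0))) 0 z.
  rewrite RInt_comp_lin; last exact: ex_RInt_expsq.
  by congr RInt; ring.
rewrite (RInt_ext _ (fun y => scal (-1) (expsq y))).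
  rewrite RInt_scal; last exact: ex_RInt_expsq.
  by rewrite /scal /= /mult /=; ring.
by move=> y _; congr scal; rewrite /expsq; congr exp; field.
Qed.

Lemma gauss_area_bounds z : 0 <= z ->
  1 / 2 - 2 * / (1 + z ^ 2 / 2) <= gauss_area z <= 1 / 2.
Proof.
move=> z0; have [lo hi] := RInt_expsq_bounds z0.
have U0 : 0 <= gauss_area z.
  have := gauss_area_homo z0; rewrite {1}/gauss_area RInt_point /zero /=; lra.
have pi1 : 1 < PI by have := PI2_3_2; lra.
have y0 : 0 < / (1 + z ^ 2 / 2).
  by apply: Rinv_0_lt_compat; have := pow2_ge_0 z; lra.
have U2 : gauss_area z ^ 2 * (2 * PI) = (RInt expsq 0 z) ^ 2.
  by rewrite /gauss_area Rpow_mult_distr gauss_cst_sqr; field; lra.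
move: U2 lo hi; set y := / (1 + _) in y0 *; set I := RInt _ _ _; set u := gauss_area z in U0 *.
move=> U2 lo hi; split.
  have : u ^ 2 >= 1 / 4 - y by nra.
  nra.
have : u ^ 2 <= 1 / 4 by nra.
nra.
Qed.

(** The expression vanishes at [k = 0], and its derivative is [k] times a difference of two terms
    bounded by 2. It is the bracket in the derivative computed in [heat_step]. *)
Lemma heat_remainder a k : 0 <= k ->
  Rabs (gauss (a + k) - gauss (a - k) +
    k * ((a - k) * gauss (a - k) + (a + k) * gauss (a + k))) <= 4 * k ^ 2.
Proof.
move=> k0.
pose f k := gauss (a + k) - gauss (a - k) +
    k * ((a - k) * gauss (a - k) + (a + k) * gauss (a + k)).
pose df k := k * ((1 - (a + k) ^ 2) * gauss (a + k) - (1 - (a - k) ^ 2) * gauss (a - k)).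
have dfP x : is_derive f x (df x).
  rewrite /f /df; auto_derive.
    by repeat split; eexists; apply: is_derive_gauss.
  rewrite !(is_derive_unique _ _ _ (is_derive_gauss _)) /Rminus /=; ring.
have [||c [cb E]] := @MVT_gen f 0 k df.
- by move=> x _; apply: dfP.
- move=> x _; apply/continuity_pt_filterlim/(@ex_derive_continuous R_AbsRing R_NormedModule).
  by eexists; apply: dfP.
have f0 : f 0 = 0 by rewrite /f Rplus_0_r Rminus_0_r; ring.
rewrite -[X in Rabs X]/(f k); move: E cb; rewrite f0 !Rminus_0_r => ->.
rewrite Rmin_left // Rmax_right // => -[c0 ck].
have B1 := gauss_deriv2_bound (a + c); have B2 := gauss_deriv2_bound (a - c).
rewrite !Rabs_mult (Rabs_pos_eq c) // (Rabs_pos_eq k) //.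
set p := (1 - (a + c) ^ 2) * _ in B1 *; set q := (1 - (a - c) ^ 2) * _ in B2 *.
have pq : Rabs (p - q) <= 4.
  by apply: (Rle_trans _ _ _ (Rabs_triang p (- q))); rewrite Rabs_Ropp; lra.
have pq0 := Rabs_pos (p - q).
have : c * Rabs (p - q) <= k * 4 by nra.
nra.
Qed.

Lemma is_derive_scaled_arg b sg sigma u : u ^ 2 < sigma ->
  is_derive (fun u => (b + sg * u) / sqrt (sigma - u ^ 2)) u
    (/ sqrt (sigma - u ^ 2) * (sg + (b + sg * u) / sqrt (sigma - u ^ 2) *
       (u / sqrt (sigma - u ^ 2)))).
Proof.
move=> us; have q0 : 0 < sqrt (sigma - u ^ 2) by apply: sqrt_lt_R0; lra.
have E : sigma + - (u * (u * 1)) = sigma - u ^ 2 by ring.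
by auto_derive; rewrite E; [repeat split; lra | field; lra].
Qed.

(* [gauss_area ((t - x) / sqrt s)] solves the heat equation in [s] and [x], so one
   random-walk step costs only a third-order error. *)
Lemma heat_step t x e s h : 0 < e -> e ^ 2 <= s -> 0 <= h ->
  Rabs (/ 2 * (gauss_area ((t - (x + h)) / sqrt s) + gauss_area ((t - (x - h)) / sqrt s))
        - gauss_area ((t - x) / sqrt (s + h ^ 2))) <= 2 / e ^ 3 * h ^ 3.
Proof.
move=> e0 es h0; pose sg := s + h ^ 2.
(* Interpolation at constant total variance [sg]: a coin flip of size [u] plus a Gaussian of
   variance [sg - u ^ 2], from no flip at [u = 0] to the full flip at [u = h]. *)
pose f u := / 2 * (gauss_area (((t - x) + -1 * u) / sqrt (sg - u ^ 2)) +
                   gauss_area (((t - x) + 1 * u) / sqrt (sg - u ^ 2))).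
pose q u := sqrt (sg - u ^ 2).
pose df u := / (2 * q u) * (gauss ((t - x) / q u + u / q u) - gauss ((t - x) / q u - u / q u)
   + u / q u * (((t - x) / q u - u / q u) * gauss ((t - x) / q u - u / q u)
              + ((t - x) / q u + u / q u) * gauss ((t - x) / q u + u / q u))).
have us u : 0 <= u <= h -> e ^ 2 <= sg - u ^ 2 by rewrite /sg; nra.
have e2 : 0 < e ^ 2 by nra.
have qe u : 0 <= u <= h -> e <= q u.
  by move=> /us H; rewrite -(sqrt_pow2 e); [apply: sqrt_le_1_alt | lra].
have dfP u : 0 <= u <= h -> is_derive f u (df u).
  move=> uh; have q0 : 0 < q u by have := qe u uh; lra.
  have su : u ^ 2 < sg by have := us u uh; lra.
  have -> : df u = / 2 * (/ q u * (-1 + ((t - x) + -1 * u) / q u * (u / q u)) *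
                            gauss (((t - x) + -1 * u) / q u) +
                          / q u * (1 + ((t - x) + 1 * u) / q u * (u / q u)) *
                            gauss (((t - x) + 1 * u) / q u)).
    rewrite /df (_ : (t - x + -1 * u) / q u = (t - x) / q u - u / q u); last by field; lra.
    rewrite (_ : (t - x + 1 * u) / q u = (t - x) / q u + u / q u); last by field; lra.
    by field; lra.
  apply: is_derive_scal; apply: is_derive_plus;
    apply: (@is_derive_comp R_AbsRing R_NormedModule gauss_area);
    by [exact: is_derive_gauss_area | exact: is_derive_scaled_arg].
have [||c [cb E]] := @MVT_gen f 0 h df.
- by move=> u; rewrite Rmin_left // Rmax_right // => uh; apply: dfP; lra.
- move=> u; rewrite Rmin_left // Rmax_right // => uh.
  apply/continuity_pt_filterlim/(@ex_derive_continuous R_AbsRing R_NormedModule).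
  by eexists; apply: dfP.
have fh : f h = / 2 * (gauss_area ((t - (x + h)) / sqrt s) + gauss_area ((t - (x - h)) / sqrt s)).
  rewrite /f /sg (_ : s + h ^ 2 - h ^ 2 = s); last by ring.
  by congr (_ * (gauss_area (_ / _) + gauss_area (_ / _))); ring.
have f0 : f 0 = gauss_area ((t - x) / sqrt (s + h ^ 2)).
  rewrite /f -/sg (_ : sg - 0 ^ 2 = sg); last by ring.
  by rewrite !Rmult_0_r !Rplus_0_r; field.
rewrite -fh -f0 E Rminus_0_r Rabs_mult (Rabs_pos_eq h) //.
rewrite Rmin_left // Rmax_right // in cb.
have qc := qe c cb; have q0 : 0 < q c by lra.
have k0 : 0 <= c / q c by apply: Rmult_le_pos; [lra | apply/Rlt_le/Rinv_0_lt_compat].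
have rem := heat_remainder ((t - x) / q c) k0.
rewrite /df Rabs_mult Rabs_pos_eq; last by apply/Rlt_le/Rinv_0_lt_compat; lra.
(* The remainder is quadratic in [c / q c]; with [c <= h] and [e <= q c] this gives the third-order
   bound. *)
apply: (Rle_trans _ (/ (2 * q c) * (4 * (c / q c) ^ 2) * h)).
  apply: Rmult_le_compat_r => //; apply: Rmult_le_compat_l => //.
  by apply/Rlt_le/Rinv_0_lt_compat; lra.
have -> : / (2 * q c) * (4 * (c / q c) ^ 2) * h = 2 * / q c ^ 3 * (c ^ 2 * h) by field; lra.
have -> : 2 / e ^ 3 * h ^ 3 = 2 * / e ^ 3 * (h ^ 2 * h) by field; lra.
apply: Rmult_le_compat.
- by apply: Rmult_le_pos; [lra | apply/Rlt_le/Rinv_0_lt_compat/pow_lt].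
- by apply: Rmult_le_pos => //; apply: pow2_ge_0.
- apply: Rmult_le_compat_l; first lra.
  by apply: Rinv_le_contravar; [exact: pow_lt | apply: pow_incr; lra].
- by apply: Rmult_le_compat_r => //; apply: pow_incr.
Qed.

(* [binwalk f m c] is the mean of [f (c + B)] for [B] binomial with parameters [m], 1/2. *)
Fixpoint binwalk (f : nat -> R) (m c : nat) : R :=
  if m is m'.+1 then / 2 * (binwalk f m' c.+1 + binwalk f m' c) else f c.

Lemma binwalk_le f g m c : (forall k, f k <= g k) -> binwalk f m c <= binwalk g m c.
Proof.
move=> fg; elim: m c => [|m IH] c /=; first exact: fg.
have := IH c; have := IH c.+1; lra.
Qed.

Lemma binwalkDr f y m c : binwalk (fun k => f k + y) m c = binwalk f m c + y.
Proof. by elim: m c => [|m IH] c //=; rewrite !IH; field. Qed.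

(** From [c = 0] it identifies the rate with the probability that a binomial variable is at most
    [v]; a general start makes Pascal's rule an induction step. *)
Lemma binwalk_rate v m c :
  binwalk (fun k => if (k <= v)%N then 1 else 0) m c =
  if (c <= v)%N then RM_rate (v - c) m else 0.
Proof.
elim: m c => [|m IH] c /=.
  case: ifP => // _; rewrite /RM_rate big_nat_recl // big1 => [|i _]; last exact: bin_small.
  by rewrite bin0 addn0 /=; field.
rewrite !IH; have p2 : 0 < 2 ^ m by apply: pow_lt; lra.
case: (ltngtP c v) => cv; last 1 first.
- by rewrite cv subnn /RM_rate !big_nat1 !bin0 /=; field; lra.
- have [w vw] : exists w, (v - c)%N = w.+1 by exists (v - c).-1; lia.
  have -> : (v - c.+1)%N = w by lia.
  rewrite vw /RM_rate.
  have -> : (\sum_(0 <= k < w.+2) 'C(m.+1, k) =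
      \sum_(0 <= k < w.+1) 'C(m, k) + \sum_(0 <= k < w.+2) 'C(m, k))%N.
    by have := sum_bin_rec w.+1 m; rewrite ![\sum_(0 <= k < w.+2) 'C(m, k)]big_nat_recr //=; lia.
  by rewrite plus_INR /=; field; lra.
- by field.
Qed.

(** Lindeberg replacement: each of the [m] flips is traded for a variance [h ^ 2] at the cost in
    [heat_step]. The initial smoothing width [e] keeps that cost finite. *)
Lemma binwalk_heat t e h M m c : 0 < e -> 0 <= h ->
  Rabs (binwalk (fun k => gauss_area ((t - (2 * INR k - INR M) * h) / e)) m c -
        gauss_area ((t - (2 * INR c + INR m - INR M) * h) / sqrt (e ^ 2 + INR m * h ^ 2)))
  <= INR m * (2 / e ^ 3 * h ^ 3).
Proof.
move=> e0 h0; elim: m c => [|m IH] c.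
  rewrite /= !Rmult_0_l !Rplus_0_r Rmult_1_r sqrt_square; last lra.
  by rewrite Rminus_diag Rabs_R0; lra.
have m0 := pos_INR m.
have s0 : e ^ 2 <= e ^ 2 + INR m * h ^ 2 by have := pow2_ge_0 h; nra.
have := heat_step t ((2 * INR c + INR m.+1 - INR M) * h) e0 s0 h0.
have := IH c; have := IH c.+1; rewrite [binwalk _ _.+1 _]/= !S_INR.
rewrite (_ : (2 * (INR c + 1) + INR m - INR M) * h =
   (2 * INR c + (INR m + 1) - INR M) * h + h); last by ring.
rewrite (_ : (2 * INR c + INR m - INR M) * h =
   (2 * INR c + (INR m + 1) - INR M) * h - h); last by ring.
rewrite (_ : e ^ 2 + (INR m + 1) * h ^ 2 = e ^ 2 + INR m * h ^ 2 + h ^ 2); last by ring.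
set K := 2 / e ^ 3 * h ^ 3.
set b1 := binwalk _ _ _; set b2 := binwalk _ _ _.
set g1 := gauss_area (_ / sqrt (_ + INR m * _)); set g2 := gauss_area (_ / sqrt (_ + INR m * _)).
set g := gauss_area (_ / _).
rewrite Rmult_plus_distr_r Rmult_1_l.
move: (INR m * K) => mK; split_Rabs; lra.
Qed.

End CLT.

(** * Limit of the rate *)

Section RateLimit.
Local Open Scope R_scope.

Lemma gauss_area_ge z d : 0 < d -> / d <= z -> 1 / 2 - 4 * d ^ 2 <= gauss_area z.
Proof.
move=> d0 dz; have i0 : 0 < / d by apply: Rinv_0_lt_compat.
apply: (Rle_trans _ _ _ _ (gauss_area_homo dz)).
have [lo _] := gauss_area_bounds (Rlt_le _ _ i0); apply: Rle_trans lo.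
have : / (1 + (/ d) ^ 2 / 2) <= / ((/ d) ^ 2 / 2).
  by apply: Rinv_le_contravar; nra.
rewrite (_ : / ((/ d) ^ 2 / 2) = 2 * d ^ 2); last by field; lra.
lra.
Qed.

Lemma gauss_area_le_half z : gauss_area z <= 1 / 2.
Proof.
have [z0|z0] := Rle_or_lt 0 z; first by have [] := gauss_area_bounds z0.
apply: (Rle_trans _ (gauss_area 0)); first by apply: gauss_area_homo; lra.
by have [] := gauss_area_bounds (Rle_refl 0).
Qed.

Lemma gauss_area_ge_half z : - (1 / 2) <= gauss_area z.
Proof. by have := gauss_area_le_half (- z); rewrite gauss_area_opp; lra. Qed.

Lemma RInt_gauss a b : RInt gauss a b = gauss_area b - gauss_area a.
Proof.
apply: is_RInt_unique; apply: (is_RInt_derive gauss_area gauss) => x _.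
  exact: is_derive_gauss_area.
by apply: ex_derive_continuous; eexists; apply: is_derive_gauss.
Qed.

Lemma Qval_gauss_area t q : Qval t q -> q = 1 / 2 - gauss_area t.
Proof.
move=> H; apply: Rminus_diag_uniq; apply: cond_eq => eps eps0.
have [B HB] := H (eps / 2) ltac:(lra).
pose d := Rmin 1 (eps / 16).
have d0 : 0 < d by apply: Rmin_pos; lra.
have d1 : d <= 1 := Rmin_l _ _; have d2 : d <= eps / 16 := Rmin_r _ _.
(* Past [/ d] the area is within [4 * d ^ 2], hence [eps / 4], of its limit 1/2. *)
pose b := Rmax (Rmax B t) (/ d).
have bB : B <= b by apply: Rle_trans (Rmax_l _ _); apply: Rmax_l.
have bt : t <= b by apply: Rle_trans (Rmax_l _ _); apply: Rmax_r.
have [pr] := HB b bB bt; rewrite -RInt_Reals RInt_gauss.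
have := gauss_area_le_half b; have := gauss_area_ge d0 (Rmax_r _ _ : / d <= b).
have : 4 * d ^ 2 <= eps / 4 by nra.
rewrite Rminus_0_r; split_Rabs; lra.
Qed.

(** For a nonnegative argument the truncation at 0 is inert and an integer lies below the floor
    exactly when it lies below the argument, so the cutoff becomes that of the standardised
    binomial. *)
Lemma v_seqP t M k : (0 < M)%N -> 0 <= INR M / 2 + sqrt (INR M) / 2 * t ->
  (k <= v_seq t M)%N <-> (2 * INR k - INR M) * / sqrt (INR M) <= t.
Proof.
move=> M0 x0; have s0 : 0 < sqrt (INR M) by apply/sqrt_lt_R0/lt_0_INR; lia.
have ss : sqrt (INR M) * sqrt (INR M) = INR M by apply: sqrt_sqrt; apply: pos_INR.
set x := INR M / 2 + _ in x0.
have -> : (k <= v_seq t M)%N <-> INR k <= x.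
  have [lo hi] := base_Int_part x.
  have i0 : Z.le Z0 (Int_part x) by apply/Z.lt_succ_r; apply: lt_IZR; rewrite succ_IZR; lra.
  rewrite /v_seq -/x Z.max_l //; split => [kv|kx].
    apply: Rle_trans lo; rewrite INR_IZR_INZ; apply: IZR_le; lia.
  have : Z.lt (Z.of_nat k) (Z.succ (Int_part x)).
    by apply: lt_IZR; rewrite succ_IZR -INR_IZR_INZ; lra.
  lia.
have -> : (2 * INR k - INR M) * / sqrt (INR M) <= t <-> 2 * INR k - INR M <= t * sqrt (INR M).
  split=> H.
    by apply: (Rmult_le_reg_r (/ sqrt (INR M)));
      [exact: Rinv_0_lt_compat | rewrite Rmult_assoc Rinv_r ?Rmult_1_r; lra].
  by apply: (Rmult_le_reg_r (sqrt (INR M))); [|rewrite Rmult_assoc Rinv_l ?Rmult_1_r; lra].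
rewrite /x; lra.
Qed.

(** The area is 1-Lipschitz and [sqrt (1 + d ^ 4)] lies between 1 and [1 + d]. This absorbs the
    shift and the extra variance introduced by smoothing. *)
Lemma gauss_area_rescale t d y : 0 < d -> d <= 1 -> Rabs y <= d ->
  Rabs (gauss_area ((t + y) / sqrt (1 + d ^ 4)) - gauss_area t) <= d * (1 + Rabs t).
Proof.
move=> d0 d1 yd; apply: (Rle_trans _ _ _ (gauss_area_lip _ _)).
have d4 : 0 <= d ^ 4 <= d.
  have d3 : d ^ 3 <= 1 by rewrite -(pow1 3); apply: pow_incr; lra.
  split; [exact/Rlt_le/pow_lt | rewrite -[d ^ 4]/(d * d ^ 3); nra].
set s := sqrt _; have s2 : s * s = 1 + d ^ 4 by apply: sqrt_sqrt; lra.
have s_ge0 : 0 <= s := sqrt_pos _.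
have s1 : 1 <= s by nra.
have s3 : s <= 1 + d by nra.
have i0 : 0 < / s by apply: Rinv_0_lt_compat; lra.
have i1 : / s <= 1 by rewrite -[X in _ <= X]Rinv_1; apply: Rinv_le_contravar; lra.
have si : s * / s = 1 by apply: Rinv_r; lra.
have i2 : 1 - d <= / s by nra.
have -> : (t + y) / s - t = y * / s + t * (/ s - 1) by field; lra.
apply: (Rle_trans _ _ _ (Rabs_triang _ _)); rewrite !Rabs_mult (Rabs_pos_eq (/ s)); last lra.
have : Rabs (/ s - 1) <= d by apply: Rabs_le; lra.
have := Rabs_pos t; have := Rabs_pos y; have := Rabs_pos (/ s - 1); nra.
Qed.

Lemma RM_rate_error t M d : (0 < M)%N -> 0 <= INR M / 2 + sqrt (INR M) / 2 * t ->
  0 < d -> d <= 1 ->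
  Rabs (RM_rate (v_seq t M) M - (1 / 2 + gauss_area t)) <=
  d * (5 + Rabs t) + 2 / d ^ 6 * / sqrt (INR M).
Proof.
move=> M0 x0 d0 d1; set h := / sqrt (INR M).
have s0 : 0 < sqrt (INR M) by apply/sqrt_lt_R0/lt_0_INR; lia.
have ss : sqrt (INR M) * sqrt (INR M) = INR M by apply: sqrt_sqrt; apply: pos_INR.
have h0 : 0 < h by apply: Rinv_0_lt_compat.
have Mh : INR M * h ^ 2 = 1 by rewrite -{1}ss /h; field; lra.
have e0 : 0 < d ^ 2 by apply: pow_lt.
have de : d / d ^ 2 = / d by field; lra.
have ie : 0 < / d ^ 2 by apply: Rinv_0_lt_compat.
(* Smoothing width [d ^ 2] against a shift by [d]: past the shift the argument exceeds [/ d] in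
   size, so the Gaussian tail is at most [4 * d ^ 2]. *)
pose f s k := gauss_area ((s - (2 * INR k - INR M) * h) / d ^ 2).
have heat s : Rabs (binwalk (f s) M 0 - gauss_area (s / sqrt (1 + d ^ 4))) <= 2 / d ^ 6 * h.
  have := binwalk_heat s M M 0 e0 (Rlt_le _ _ h0).
  rewrite Mh (_ : INR M * _ = 2 / d ^ 6 * (INR M * h ^ 2 * h)); last by field; lra.
  rewrite Mh Rmult_1_l (_ : (d ^ 2) ^ 2 + 1 = 1 + d ^ 4); last by ring.
  by rewrite (_ : s - (2 * INR 0 + INR M - INR M) * h = s); last by rewrite /=; ring.
have rateE : RM_rate (v_seq t M) M =
    binwalk (fun k => if (k <= v_seq t M)%N then 1 else 0) M 0.
  by rewrite binwalk_rate leq0n subn0.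
(* The indicator of [k <= v_seq t M] is sandwiched between smoothed steps centred at [t + d] and
   [t - d]. *)
have up : RM_rate (v_seq t M) M <= binwalk (f (t + d)) M 0 + (1 / 2 + 4 * d ^ 2).
  rewrite rateE -binwalkDr; apply: binwalk_le => k; case: ifP => kv.
    have /(v_seqP _ M0 x0) kt := kv; rewrite -/h in kt.
    have : 1 / 2 - 4 * d ^ 2 <= f (t + d) k.
      apply: gauss_area_ge => //; rewrite -de; apply: Rmult_le_compat_r; lra.
    lra.
  have := gauss_area_ge_half ((t + d - (2 * INR k - INR M) * h) / d ^ 2).
  by rewrite -/(f (t + d) k); nra.
have lo : binwalk (f (t - d)) M 0 + (1 / 2 - 4 * d ^ 2) <= RM_rate (v_seq t M) M.
  rewrite rateE -binwalkDr; apply: binwalk_le => k; case: ifP => kv.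
    have := gauss_area_le_half ((t - d - (2 * INR k - INR M) * h) / d ^ 2).
    by rewrite -/(f (t - d) k); nra.
  have kt : t < (2 * INR k - INR M) * h.
    by apply: Rnot_le_lt => /(v_seqP _ M0 x0); rewrite kv.
  have : 1 / 2 - 4 * d ^ 2 <= - f (t - d) k.
    rewrite /f -gauss_area_opp; apply: gauss_area_ge => //.
    by rewrite -de /Rdiv -Ropp_mult_distr_l_reverse; apply: Rmult_le_compat_r; lra.
  lra.
have H1 := heat (t + d); have H2 := heat (t - d).
have R1 : Rabs (gauss_area ((t + d) / sqrt (1 + d ^ 4)) - gauss_area t) <= d * (1 + Rabs t).
  by apply: gauss_area_rescale => //; rewrite Rabs_pos_eq; lra.
have R2 : Rabs (gauss_area ((t - d) / sqrt (1 + d ^ 4)) - gauss_area t) <= d * (1 + Rabs t).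
  by apply: gauss_area_rescale => //; rewrite Rabs_Ropp Rabs_pos_eq; lra.
have d2 : 4 * d ^ 2 <= 4 * d by simpl; nra.
move: R1 R2 H1 H2; set K := 2 / d ^ 6 * h.
have -> : d * (5 + Rabs t) = d * (1 + Rabs t) + 4 * d by ring.
move: (d * (1 + Rabs t)) => D /Rabs_le_between R1 /Rabs_le_between R2
  /Rabs_le_between H1 /Rabs_le_between H2.
by apply: Rabs_le; lra.
Qed.

Lemma RM_rate_cv t r : Qval t (1 - r) -> Un_cv (fun m => RM_rate (v_seq t m) m) r.
Proof.
move=> /Qval_gauss_area Hr; have {Hr} -> : r = 1 / 2 + gauss_area t by lra.
move=> eps eps0; have t0 := Rabs_pos t.
pose d := Rmin 1 (eps / (2 * (5 + Rabs t))).
have d0 : 0 < d by apply: Rmin_pos; [lra | apply: Rdiv_lt_0_compat; lra].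
have d1 : d <= 1 := Rmin_l _ _.
have dt : d * (5 + Rabs t) <= eps / 2.
  have : d <= eps / (2 * (5 + Rabs t)) := Rmin_r _ _.
  move/(Rmult_le_compat_r (5 + Rabs t)) => /(_ ltac:(lra)).
  by rewrite (_ : eps / _ * _ = eps / 2); [|field; lra].
have d6 : 0 < d ^ 6 by apply: pow_lt.
(* Once [sqrt (INR M)] exceeds [Rabs t] the argument of the floor is nonnegative; exceeding the
   other bound makes the replacement error less than [eps / 2]. *)
pose B := Rmax (Rabs t) (5 / (d ^ 6 * eps)).
have B0 : 0 <= B by apply: Rle_trans (Rmax_l _ _).
have [N HN] := INR_unbounded (B ^ 2).
exists N.+1 => M MN; have M0 : (0 < M)%N by lia.
have sB : B < sqrt (INR M).
  rewrite -(sqrt_pow2 B) //; apply: sqrt_lt_1_alt; split; first exact: pow2_ge_0.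
  by apply: (Rlt_le_trans _ _ _ HN); apply: le_INR; lia.
have s0 : 0 < sqrt (INR M) by lra.
have ss : sqrt (INR M) * sqrt (INR M) = INR M by apply: sqrt_sqrt; apply: pos_INR.
have tB : Rabs t <= B := Rmax_l _ _.
have x0 : 0 <= INR M / 2 + sqrt (INR M) / 2 * t.
  have : - Rabs t <= t by split_Rabs; lra.
  nra.
apply: (Rle_lt_trans _ _ _ (RM_rate_error M0 x0 d0 d1)).
have : 2 / d ^ 6 * / sqrt (INR M) < eps / 2.
  apply: (Rmult_lt_reg_r (sqrt (INR M))) => //; rewrite Rmult_assoc Rinv_l; last lra.
  have : 5 / (d ^ 6 * eps) <= B := Rmax_r _ _.
  move=> H; have {H} : 5 / (d ^ 6 * eps) < sqrt (INR M) by lra.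
  move/(Rmult_lt_compat_l (eps / 2)) => /(_ ltac:(lra)).
  rewrite (_ : eps / 2 * (5 / _) = 5 / 2 * / d ^ 6); last by field; lra.
  have : 0 < / d ^ 6 by apply: Rinv_0_lt_compat.
  rewrite /Rdiv; lra.
lra.
Qed.

End RateLimit.

Unset Implicit Arguments.
Local Open Scope R_scope.

Theorem theorem6 (r t : R) (hr0 : 0 < r) (hr1 : r < 1)
  (ht : Qval t (1 - r)) (* t = Q^{-1}(1 - r) *) :
  Un_cv (fun m => RM_rate (v_seq t m) m) r /\
  (forall p, 0 <= p -> p < 1 - r ->
     Un_cv (fun m => RM_Pb (v_seq t m) m p) 0).
Proof.
have rate_cv := RM_rate_cv ht; split=> // p p0 pr.
exact: RM_Pb_cv rate_cv p0 pr.
Qed.
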